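(* Let $H$ be a bialgebra. Let $\sigma: H\otimes H\to A$ be a linear map, where $A$ is a left $H$-comodule coalgebra and an algebra with a left $H$-weak action $\triangleright$, such that $\varepsilon_A(1_A)=1$ and $\varepsilon_A(\sigma(x,x'))=\varepsilon_H(x)\varepsilon_H(x')$. Let $\tau: H\otimes H\to B$ be a linear map, where $B$ is a right $H$-comodule coalgebra and an algebra with a right $H$-weak action $\triangleleft$, such that $\varepsilon_B(1_B)=1$ and $\varepsilon_B(\tau(x,x'))=\varepsilon_H(x)\varepsilon_H(x')$. Then the two-sided crossed product algebra $A\#^{\sigma}H\,{}^{\tau}\#B$ equipped with the two-sided smash coproduct coalgebra $A\times H\times B$ becomes a bialgebra if and only if the following conditions hold for all $a,a'\in A$, $b,b'\in B$, $x,x'\in H$: (C1) $\varepsilon_A$ and $\varepsilon_B$ are algebra maps; (C2) $\Delta_A(1_A)=1_A\otimes 1_A$, $\Delta_B(1_B)=1_B\otimes 1_B$; (C3) $1_{A(-1)}\otimes 1_{A(0)}=1_H\otimes 1_A$, $1_{B[0]}\otimes 1_{B[1]}=1_B\otimes 1_H$; (C4) $\varepsilon_A(x\triangleright a)=\varepsilon_A(a)\varepsilon_H(x)$, $\varepsilon_B(b\triangleleft x)=\varepsilon_B(b)\varepsilon_H(x)$; (C5) $a_1\otimes a_{2(-1)}x\otimes a_{2(0)}=a_1\sigma(a_{2(-1)1},x_1)\otimes a_{2(-1)2}x_2\otimes a_{2(0)}$; (C6) $b_{1[0]}\otimes xb_{1[1]}\otimes b_2=b_{1[0]}\otimes x_1b_{1[1]1}\otimes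 \tau(x_2,b_{1[1]2})b_2$; (D7) $(aa')_1\otimes (aa')_2=a_1(a_{2(-1)1}\triangleright a'_1)\sigma(a_{2(-1)2},a'_{2(-1)})\otimes a_{2(0)}a'_{2(0)}$; (D8) $(aa')_{(-1)}\otimes (aa')_{(0)}=a_{(-1)}a'_{(-1)}\otimes a_{(0)}a'_{(0)}$; (D9) $(bb')_1\otimes (bb')_2=b_{1[0]}b'_{1[0]}\otimes \tau(b_{1[1]},b'_{1[1]1})(b_2\triangleleft b'_{1[1]2})b'_2$; (D10) $(bb')_{[0]}\otimes (bb')_{[1]}=b_{[0]}b'_{[0]}\otimes b_{[1]}b'_{[1]}$; (D11) $\sigma(x_1,x'_1)_{(-1)}x_2x'_2\otimes \sigma(x_1,x'_1)_{(0)}=x_1x'_1\otimes \sigma(x_2,x'_2)$; (D12) $\sigma(x,x')_1\otimes \sigma(x,x')_2=\sigma(x_1,x'_1)\otimes \sigma(x_2,x'_2)$; (D13) $\tau(x_2,x'_2)_{[0]}\otimes x_1x'_1\tau(x_2,x'_2)_{[1]}=\tau(x_1,x'_1)\otimes x_2x'_2$; (D14) $\tau(x,x')_1\otimes \tau(x,x')_2=\tau(x_1,x'_1)\otimes \tau(x_2,x'_2)$; (D15) $(x\triangleright a)_1\otimes (x\triangleright a)_2=(x_1\triangleright a_1)\sigma(x_2,a_{2(-1)})\otimes x_3\triangleright a_{2(0)}$; (D16) $(x_1\triangleright a)_{(-1)}x_2\otimes (x_1\triangleright a)_{(0)}=x_1a_{(-1)}\otimes x_2\triangleright a_{(0)}$;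 (D17) $(b\triangleleft x_2)_{[0]}\otimes x_1(b\triangleleft x_2)_{[1]}=b_{[0]}\triangleleft x_1\otimes b_{[1]}x_2$; (D18) $(b\triangleleft x)_1\otimes (b\triangleleft x)_2=b_{1[0]}\triangleleft x_1\otimes \tau(b_{1[1]},x_2)(b_2\triangleleft x_3)$; (D19) $a_{(-1)}x\otimes 1_B\otimes a_{(0)}=a_{(-1)1}x_1\otimes \tau(a_{(-1)2},x_2)\otimes a_{(0)}$; (D20) $b_{[0]}\otimes 1_A\otimes xb_{[1]}=b_{[0]}\otimes \sigma(x_1,b_{[1]1})\otimes x_2b_{[1]2}$; (D21) $b_{[1]}\triangleright a_{(0)}\otimes b_{[0]}\triangleleft a_{(-1)}=a\otimes b$; (D22) $\tau(x_3,x'_2)(b\triangleleft x'_3)b'\otimes a(x_1\triangleright a')\sigma(x_2,x'_1)=\tau(a_{(-1)}x_1,a'_{(-1)}x'_1)(b_{[0]}\triangleleft x'_2)b'_{[0]}\otimes a_{(0)}(x_2\triangleright a'_{(0)})\sigma(x_3b_{[1]},x'_3b'_{[1]})$.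
   Context: Everything is over a field $K$. Comultiplications are written $\Delta(c)=c_1\otimes c_2$, $c_1\otimes c_2\otimes c_3$, etc. The left coaction on $A$ is $a\mapsto a_{(-1)}\otimes a_{(0)}\in H\otimes A$, the right coaction on $B$ is $b\mapsto b_{[0]}\otimes b_{[1]}\in B\otimes H$; subscripts are read left to right, e.g. $a_{2(-1)1}\otimes a_{2(-1)2}=\Delta_H((a_2)_{(-1)})$ and $b_{1[1]1}\otimes b_{1[1]2}=\Delta_H((b_1)_{[1]})$. A left $H$-comodule coalgebra is a coalgebra that is a left $H$-comodule whose comultiplication and counit are comodule maps ($a_{(-1)}\otimes a_{(0)1}\otimes a_{(0)2}=a_{1(-1)}a_{2(-1)}\otimes a_{1(0)}\otimes a_{2(0)}$, $a_{(-1)}\varepsilon(a_{(0)})=\varepsilon(a)1_H$); right comodule coalgebras are defined analogously. A left weak action of $H$ on an algebra $A$ is a linear map $H\otimes A\to A$, $x\otimes a\mapsto x\triangleright a$, with $x\triangleright(aa')=(x_1\triangleright a)(x_2\triangleright a')$, $x\triangleright 1_A=\varepsilon(x)1_A$, $1_H\triangleright a=a$; a right weak action $\triangleleft: B\otimes H\to B$ satisfies $(bb')\triangleleft x=(b\triangleleft x_1)(b'\triangleleft x_2)$, $1_B\triangleleft x=\varepsilon(x)1_B$, $b\triangleleft 1_H=b$. Two-sided crossed product algebra $A\#^{\sigma}H\,{}^{\tau}\#B$: it is understood that $A\#^\sigma H$ is a left crossed product and $H\,{}^\tau\#B$ a right crossed product, i.e. for all $x,x',x''\in H$, $a\in A$,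 $b\in B$: $\sigma(x,1_H)=\sigma(1_H,x)=\varepsilon(x)1_A$; $(x_1\triangleright\sigma(x'_1,x''_1))\sigma(x_2,x'_2x''_2)=\sigma(x_1,x'_1)\sigma(x_2x'_2,x'')$; $(x_1\triangleright(x'_1\triangleright a))\sigma(x_2,x'_2)=\sigma(x_1,x'_1)(x_2x'_2\triangleright a)$; $\tau(x,1_H)=\tau(1_H,x)=\varepsilon(x)1_B$; $\tau(x_1x'_1,x''_1)(\tau(x_2,x'_2)\triangleleft x''_2)=\tau(x,x'_1x''_1)\tau(x'_2,x''_2)$; $\tau(x'_1,x''_1)((b\triangleleft x'_2)\triangleleft x''_2)=(b\triangleleft x'_1x''_1)\tau(x'_2,x''_2)$. Then $A\#^{\sigma}H\,{}^{\tau}\#B$ is $A\otimes H\otimes B$ with unit $1_A\otimes 1_H\otimes 1_B$ and (associative) multiplication $$(a\otimes x\otimes b)(a'\otimes x'\otimes b')=a(x_1\triangleright a')\sigma(x_2,x'_1)\otimes x_3x'_2\otimes \tau(x_4,x'_3)(b\triangleleft x'_4)b'.$$ Two-sided smash coproduct coalgebra $A\times H\times B$: $A\otimes H\otimes B$ with counit $\varepsilon(a\otimes x\otimes b)=\varepsilon_A(a)\varepsilon_H(x)\varepsilon_B(b)$ and comultiplication $$\Delta(a\otimes x\otimes b)=a_1\otimes a_{2(-1)}x_1\otimes b_{1[0]}\otimes a_{2(0)}\otimes x_2b_{1[1]}\otimes b_2.$$ *)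

(* Defs.v *)
From HB Require Import structures.
From mathcomp Require Import all_boot all_algebra.
From mathcomp Require Import boolp.

Set Implicit Arguments.
Unset Strict Implicit.
Unset Printing Implicit Defensive.

Import GRing.Theory.
Local Open Scope ring_scope.
Local Open Scope quotient_scope.

(* A formal sum v_1 (x) w_1 + ... + v_n (x) w_n is the sequence of pairs
   (v_i, w_i).  The tensor product is the quotient of the commutative monoid of
   formal sums by the congruence generated by K-balanced biadditivity. *)
Inductive tensor_rel (K : fieldType) (V W : lmodType K) :
    seq (V * W) -> seq (V * W) -> Prop :=
| tensor_refl s : tensor_rel s s
| tensor_sym s t : tensor_rel s t -> tensor_rel t s
| tensor_trans s t u : tensor_rel s t -> tensor_rel t u -> tensor_rel s u
| tensor_cat s s' t t' :
    tensor_rel s s' -> tensor_rel t t' -> tensor_rel (s ++ t) (s' ++ t')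
| tensor_catC s t : tensor_rel (s ++ t) (t ++ s)
| tensor_0 w : tensor_rel [:: (0, w)] [::]
| tensor_addl v v' w : tensor_rel [:: (v + v', w)] [:: (v, w); (v', w)]
| tensor_addr v w w' : tensor_rel [:: (v, w + w')] [:: (v, w); (v, w')]
| tensor_scale k v w : tensor_rel [:: (k *: v, w)] [:: (v, k *: w)].

Section Tensor.
Variables (K : fieldType) (V W : lmodType K).
Implicit Types s t : seq (V * W).

Definition tensor_relb s t : bool := `[< tensor_rel s t >].

Lemma tensor_relb_refl : reflexive tensor_relb.
Proof. by move=> s; apply/asboolP; exact: tensor_refl. Qed.

Lemma tensor_relb_sym : symmetric tensor_relb.
Proof. by move=> s t; apply/asboolP/asboolP; exact: tensor_sym. Qed.

Lemma tensor_relb_trans : transitive tensor_relb.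
Proof.
by move=> s t u /asboolP H /asboolP H'; apply/asboolP; exact: tensor_trans H'.
Qed.

Canonical tensor_equiv :=
  EquivRel tensor_relb tensor_relb_refl tensor_relb_sym tensor_relb_trans.

Definition tensor := {eq_quot tensor_equiv}.
HB.instance Definition _ := Choice.on tensor.
HB.instance Definition _ := EqQuotient.on tensor.

Lemma tensor_eqP s t : tensor_rel s t <-> \pi_tensor s = \pi_tensor t.
Proof.
split=> [st|/eqmodP/asboolP //].
by apply/eqmodP/asboolP.
Qed.

Lemma tensor_repr s : tensor_rel (repr (\pi_tensor s)) s.
Proof. by apply/tensor_eqP; rewrite reprK. Qed.

Definition tensor_add (u v : tensor) : tensor := \pi_tensor (repr u ++ repr v).

Definition scale_formal (k : K) s := [seq (k *: p.1, p.2) | p <- s].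
Definition tensor_scaling (k : K) (u : tensor) : tensor :=
  \pi_tensor (scale_formal k (repr u)).

Lemma tensor_addE s t : tensor_add (\pi s) (\pi t) = \pi_tensor (s ++ t).
Proof. by apply/tensor_eqP/tensor_cat; exact: tensor_repr. Qed.

Lemma scale_formal_rel k s t :
  tensor_rel s t -> tensor_rel (scale_formal k s) (scale_formal k t).
Proof.
rewrite /scale_formal; elim=> {s t} /=.
- by move=> s; exact: tensor_refl.
- by move=> s t _; exact: tensor_sym.
- by move=> s t u _ H _; exact: tensor_trans.
- by move=> s s' t t' _ H _ H'; rewrite !map_cat; exact: tensor_cat.
- by move=> s t; rewrite !map_cat; exact: tensor_catC.
- by move=> w; rewrite scaler0; exact: tensor_0.
- by move=> v v' w; rewrite scalerDr; exact: tensor_addl.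
- by move=> v w w'; exact: tensor_addr.
- by move=> l v w; rewrite scalerA mulrC -scalerA; exact: tensor_scale.
Qed.

Lemma tensor_scalingE k s : tensor_scaling k (\pi s) = \pi_tensor (scale_formal k s).
Proof. by apply/tensor_eqP/scale_formal_rel; exact: tensor_repr. Qed.

Lemma tensor_ind (P : tensor -> Prop) : (forall s, P (\pi_tensor s)) -> forall u, P u.
Proof. by move=> H u; rewrite -[u]reprK. Qed.

Definition tensor_zero : tensor := \pi_tensor [::].
Definition tensor_opp (u : tensor) : tensor := tensor_scaling (-1) u.

Lemma tensor_addA : associative tensor_add.
Proof.
move=> x y z; elim/tensor_ind: x => s; elim/tensor_ind: y => t.
elim/tensor_ind: z => u.
by rewrite (tensor_addE t u) (tensor_addE s t) !tensor_addE catA.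
Qed.

Lemma tensor_addC : commutative tensor_add.
Proof.
move=> x y; elim/tensor_ind: x => s; elim/tensor_ind: y => t.
rewrite !tensor_addE.
by apply/tensor_eqP; exact: tensor_catC.
Qed.

Lemma tensor_add0 : left_id tensor_zero tensor_add.
Proof. by move=> x; elim/tensor_ind: x => s; rewrite tensor_addE. Qed.

Lemma scale_formalDl k l s :
  tensor_rel (scale_formal (k + l) s) (scale_formal k s ++ scale_formal l s).
Proof.
rewrite /scale_formal; elim: s => [|[v w] s IHs] /=; first exact: tensor_refl.
rewrite scalerDl -[(_, w) :: _]cat1s.
apply: (@tensor_trans _ _ _ _ ([:: (k *: v, w); (l *: v, w)] ++
  ([seq (k *: p.1, p.2) | p <- s] ++ [seq (l *: p.1, p.2) | p <- s]))).
  by apply: tensor_cat => //; exact: tensor_addl.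
rewrite /= -[(k *: v, w) :: _]cat1s -[(k *: v, w) :: _ ++ _]cat1s.
apply: tensor_cat; first exact: tensor_refl.
rewrite -cat1s -[(l *: v, w) :: map _ _]cat1s !catA.
by apply: tensor_cat; [exact: tensor_catC | exact: tensor_refl].
Qed.

Lemma scale_formal0 s : tensor_rel (scale_formal 0 s) [::].
Proof.
rewrite /scale_formal; elim: s => [|[v w] s IHs] /=; first exact: tensor_refl.
by rewrite scale0r -cat1s -[[::]]cats0; apply: tensor_cat => //; exact: tensor_0.
Qed.

Lemma scale_formal1 s : scale_formal 1 s = s.
Proof.
by rewrite /scale_formal -[RHS]map_id; apply: eq_map => -[v w] /=; rewrite scale1r.
Qed.

Lemma tensor_addN : left_inverse tensor_zero tensor_opp tensor_add.
Proof.
move=> x; elim/tensor_ind: x => s; rewrite /tensor_opp tensor_scalingE tensor_addE.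
apply/tensor_eqP; rewrite -{2}[s]scale_formal1.
apply: (tensor_trans (tensor_sym (scale_formalDl _ _ _))).
by rewrite addNr; exact: scale_formal0.
Qed.

HB.instance Definition _ := GRing.isZmodule.Build tensor
  tensor_addA tensor_addC tensor_add0 tensor_addN.

Lemma pi_cat s t : \pi_tensor (s ++ t) = \pi_tensor s + \pi_tensor t.
Proof. by rewrite -tensor_addE. Qed.

Lemma tensor_scaleA k l (u : tensor) :
  tensor_scaling k (tensor_scaling l u) = tensor_scaling (k * l) u.
Proof.
elim/tensor_ind: u => s.
rewrite (tensor_scalingE l s) !tensor_scalingE /scale_formal -map_comp.
by congr (\pi_tensor _); apply: eq_map => p /=; rewrite scalerA.
Qed.

Lemma tensor_scale1 : left_id 1 tensor_scaling.
Proof. by move=> x; elim/tensor_ind: x => s; rewrite tensor_scalingE scale_formal1. Qed.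

Lemma tensor_scaleDr : right_distributive tensor_scaling +%R.
Proof.
move=> k x y; elim/tensor_ind: x => s; elim/tensor_ind: y => t.
by rewrite -pi_cat !tensor_scalingE /scale_formal map_cat pi_cat.
Qed.

Lemma tensor_scaleDl (u : tensor) :
  {morph tensor_scaling^~ u : k l / k + l}.
Proof.
move=> k l; elim/tensor_ind: u => s.
rewrite !tensor_scalingE -pi_cat.
by apply/tensor_eqP; exact: scale_formalDl.
Qed.

HB.instance Definition _ := GRing.Zmodule_isLmodule.Build K tensor
  tensor_scaleA tensor_scale1 tensor_scaleDr tensor_scaleDl.

Lemma pi_scale k s : \pi_tensor (scale_formal k s) = k *: \pi_tensor s.
Proof. by rewrite -tensor_scalingE. Qed.

Definition pure_tensor (v : V) (w : W) : tensor := \pi_tensor [:: (v, w)].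

End Tensor.

Notation "V ⊗ W" := (tensor V W) (at level 45, right associativity) : type_scope.
Notation "v ⊗ w" := (pure_tensor v w) (at level 45, right associativity) : ring_scope.

(* [sweedler t f] is the sum of the f v_i w_i, where t = \sum_i v_i ⊗ w_i is a
   chosen decomposition of t.  By [sweedler_pure] and [sweedler_linear] below, for
   bilinear f this is the value at t of the linear map induced by f; it is only
   ever used with bodies that are bilinear in the bound variables. *)
Definition sweedler (K : fieldType) (V W : lmodType K) (Z : nmodType)
  (t : (V ⊗ W)%type) (f : V -> W -> Z) : Z := \sum_(p <- repr t) f p.1 p.2.

Notation "\sw_ ( x , y <- t ) e" := (sweedler t (fun x y => e))
  (at level 46, x name, y name, t at level 200, e at level 46,
   format "'[' \sw_ ( x ,  y  <-  t ) '/  '  e ']'") : ring_scope.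
Notation "\sw_ ( x , y , z <- t ) e" :=
  (sweedler t (fun x t' => sweedler t' (fun y z => e)))
  (at level 46, x name, y name, z name, t at level 200, e at level 46,
   format "'[' \sw_ ( x ,  y ,  z  <-  t ) '/  '  e ']'") : ring_scope.
Notation "\sw_ ( x , y , z , w <- t ) e" :=
  (sweedler t (fun x t' => sweedler t' (fun y t'' => sweedler t'' (fun z w => e))))
  (at level 46, x name, y name, z name, w name, t at level 200, e at level 46,
   format "'[' \sw_ ( x ,  y ,  z ,  w  <-  t ) '/  '  e ']'") : ring_scope.

Section SweedlerTheory.
Variables (K : fieldType) (V W : lmodType K).

Lemma pure_tensor_bilinear : bilinear_for *:%R *:%R (@pure_tensor K V W).
Proof.
split=> [w k v v'|v k w w'] /=; rewrite /pure_tensor -pi_scale -pi_cat.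
  by apply/tensor_eqP; exact: tensor_addl.
apply/tensor_eqP; apply: (tensor_trans (tensor_addr _ _ _)).
rewrite /= -cat1s -[X in tensor_rel _ X]cat1s.
apply: tensor_cat; last exact: tensor_refl.
by apply: tensor_sym; exact: tensor_scale.
Qed.

Variables (Z : lmodType K) (f : V -> W -> Z).
Hypothesis f_bilin : bilinear_for *:%R *:%R f.

Let fDl w v v' : f (v + v') w = f v w + f v' w.
Proof. by have := f_bilin.1 w 1 v v'; rewrite /= !scale1r. Qed.

Let fDr v w w' : f v (w + w') = f v w + f v w'.
Proof. by have := f_bilin.2 v 1 w w'; rewrite /= !scale1r. Qed.

Let f0l w : f 0 w = 0.
Proof. by apply: (addrI (f 0 w)); rewrite -fDl !addr0. Qed.

Let f0r v : f v 0 = 0.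
Proof. by apply: (addrI (f v 0)); rewrite -fDr !addr0. Qed.

Let fZl k v w : f (k *: v) w = k *: f v w.
Proof. by have := f_bilin.1 w k v 0; rewrite /= f0l !addr0. Qed.

Let fZr k v w : f v (k *: w) = k *: f v w.
Proof. by have := f_bilin.2 v k w 0; rewrite /= f0r !addr0. Qed.

Lemma sweedler_pi (s : seq (V * W)) :
  sweedler (\pi_(tensor V W) s) f = \sum_(p <- s) f p.1 p.2.
Proof.
rewrite /sweedler; move: (repr _) (tensor_repr s) => r; elim=> {r s} //=.
- by move=> s t u _ -> _ ->.
- by move=> s s' t t' _ H _ H'; rewrite !big_cat /= H H'.
- by move=> s t; rewrite !big_cat /= addrC.
- by move=> w; rewrite big_seq1 big_nil f0l.
- by move=> v v' w; rewrite big_seq1 big_cons big_seq1 /= fDl.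
- by move=> v w w'; rewrite big_seq1 big_cons big_seq1 /= fDr.
- by move=> k v w; rewrite !big_seq1 /= fZl fZr.
Qed.

Lemma sweedler_pure v w : sweedler (v ⊗ w) f = f v w.
Proof. by rewrite sweedler_pi big_seq1. Qed.

Lemma sweedler_linear : linear (fun t : (V ⊗ W)%type => sweedler t f).
Proof.
move=> k t u; elim/tensor_ind: t => s; elim/tensor_ind: u => s'.
rewrite -pi_scale -pi_cat !sweedler_pi big_cat /= big_map scaler_sumr.
by congr (_ + _); apply: eq_bigr => -[v w] _ /=; rewrite fZl.
Qed.

End SweedlerTheory.

Lemma tensorE (K : fieldType) (V W : lmodType K) (t : (V ⊗ W)%type) :
  t = \sw_(v, w <- t) v ⊗ w.
Proof.
elim/tensor_ind: t => s.
rewrite (sweedler_pi (@pure_tensor_bilinear K V W)).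
elim: s => [|[v w] s IHs]; first by rewrite big_nil.
by rewrite big_cons -IHs -cat1s pi_cat.
Qed.

Section Structures.
Variables (K : fieldType) (V : lmodType K).

Record is_algebra (mul : V -> V -> V) (one : V) : Prop := {
  alg_bilinear : bilinear_for *:%R *:%R mul;
  alg_mulA : associative mul;
  alg_mul1l : left_id one mul;
  alg_mul1r : right_id one mul
}.

Record is_coalgebra (Δ : V -> (V ⊗ V)%type) (ε : V -> K) : Prop := {
  coalg_Δ_linear : linear Δ;
  coalg_ε_linear : scalar ε;
  coalg_coassoc : forall c,
    \sw_(c1, c2 <- Δ c) \sw_(c11, c12 <- Δ c1) c11 ⊗ c12 ⊗ c2 =
    \sw_(c1, c2 <- Δ c) \sw_(c21, c22 <- Δ c2) c1 ⊗ c21 ⊗ c22;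
  coalg_counitl : forall c, \sw_(c1, c2 <- Δ c) ε c1 *: c2 = c;
  coalg_counitr : forall c, \sw_(c1, c2 <- Δ c) ε c2 *: c1 = c
}.

Definition tensor_mul (mul : V -> V -> V) (t u : (V ⊗ V)%type) : (V ⊗ V)%type :=
  \sw_(t1, t2 <- t) \sw_(u1, u2 <- u) mul t1 u1 ⊗ mul t2 u2.

Record is_bialgebra (mul : V -> V -> V) (one : V)
    (Δ : V -> (V ⊗ V)%type) (ε : V -> K) : Prop := {
  bialg_algebra : is_algebra mul one;
  bialg_coalgebra : is_coalgebra Δ ε;
  bialg_Δ1 : Δ one = one ⊗ one;
  bialg_ΔM : forall u v, Δ (mul u v) = tensor_mul mul (Δ u) (Δ v);
  bialg_ε1 : ε one = 1;
  bialg_εM : forall u v, ε (mul u v) = ε u * ε v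
}.

Definition comul3 (Δ : V -> (V ⊗ V)%type) (c : V) : (V ⊗ V ⊗ V)%type :=
  \sw_(c1, c' <- Δ c) c1 ⊗ Δ c'.
Definition comul4 (Δ : V -> (V ⊗ V)%type) (c : V) : (V ⊗ V ⊗ V ⊗ V)%type :=
  \sw_(c1, c' <- Δ c) c1 ⊗ comul3 Δ c'.

End Structures.

Section OneSided.
Variables (K : fieldType) (H : algType K).
Variables (ΔH : H -> (H ⊗ H)%type) (εH : H -> K).

Record is_left_comodule (V : lmodType K) (ρ : V -> (H ⊗ V)%type) : Prop := {
  lcomod_linear : linear ρ;
  lcomod_coassoc : forall v,
    \sw_(h, v0 <- ρ v) \sw_(h1, h2 <- ΔH h) h1 ⊗ h2 ⊗ v0 =
    \sw_(h, v0 <- ρ v) \sw_(h', v00 <- ρ v0) h ⊗ h' ⊗ v00;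
  lcomod_counit : forall v, \sw_(h, v0 <- ρ v) εH h *: v0 = v
}.

Record is_right_comodule (V : lmodType K) (ρ : V -> (V ⊗ H)%type) : Prop := {
  rcomod_linear : linear ρ;
  rcomod_coassoc : forall v,
    \sw_(v0, h <- ρ v) \sw_(v00, h' <- ρ v0) v00 ⊗ h' ⊗ h =
    \sw_(v0, h <- ρ v) \sw_(h1, h2 <- ΔH h) v0 ⊗ h1 ⊗ h2;
  rcomod_counit : forall v, \sw_(v0, h <- ρ v) εH h *: v0 = v
}.

Record is_left_comodule_coalgebra (A : lmodType K) (ΔA : A -> (A ⊗ A)%type)
    (εA : A -> K) (ρ : A -> (H ⊗ A)%type) : Prop := {
  lcc_coalgebra : is_coalgebra ΔA εA;
  lcc_comodule : is_left_comodule ρ;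
  lcc_comul : forall a,
    \sw_(h, a0 <- ρ a) \sw_(a01, a02 <- ΔA a0) h ⊗ a01 ⊗ a02 =
    \sw_(a1, a2 <- ΔA a) \sw_(h1, a10 <- ρ a1) \sw_(h2, a20 <- ρ a2)
      h1 * h2 ⊗ a10 ⊗ a20;
  lcc_counit : forall a, \sw_(h, a0 <- ρ a) εA a0 *: h = εA a *: 1
}.

Record is_right_comodule_coalgebra (B : lmodType K) (ΔB : B -> (B ⊗ B)%type)
    (εB : B -> K) (ρ : B -> (B ⊗ H)%type) : Prop := {
  rcc_coalgebra : is_coalgebra ΔB εB;
  rcc_comodule : is_right_comodule ρ;
  rcc_comul : forall b,
    \sw_(b0, h <- ρ b) \sw_(b01, b02 <- ΔB b0) b01 ⊗ b02 ⊗ h =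
    \sw_(b1, b2 <- ΔB b) \sw_(b10, h1 <- ρ b1) \sw_(b20, h2 <- ρ b2)
      b10 ⊗ b20 ⊗ h1 * h2;
  rcc_counit : forall b, \sw_(b0, h <- ρ b) εB b0 *: h = εB b *: 1
}.

Section Left.
Variables (A : algType K) (lact : {linear (H ⊗ A)%type -> A}).
Variable (σ : {linear (H ⊗ H)%type -> A}).
Local Notation "x ▷ a" := (lact (x ⊗ a)) (at level 39, left associativity).

Record is_left_weak_action : Prop := {
  lact_mul : forall x a a',
    x ▷ (a * a') = \sw_(x1, x2 <- ΔH x) (x1 ▷ a) * (x2 ▷ a');
  lact_one : forall x, x ▷ 1 = εH x *: 1;
  lact_id : forall a, 1 ▷ a = a
}.

Record is_left_crossed_product : Prop := {
  lcross_norm : forall x,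
    σ (x ⊗ 1) = εH x *: 1 /\ σ (1 ⊗ x) = εH x *: 1;
  lcross_cocycle : forall x x' x'',
    \sw_(x1, x2 <- ΔH x) \sw_(x'1, x'2 <- ΔH x') \sw_(x''1, x''2 <- ΔH x'')
      (x1 ▷ σ (x'1 ⊗ x''1)) * σ (x2 ⊗ x'2 * x''2) =
    \sw_(x1, x2 <- ΔH x) \sw_(x'1, x'2 <- ΔH x')
      σ (x1 ⊗ x'1) * σ (x2 * x'2 ⊗ x'');
  lcross_twisted : forall x x' a,
    \sw_(x1, x2 <- ΔH x) \sw_(x'1, x'2 <- ΔH x')
      (x1 ▷ (x'1 ▷ a)) * σ (x2 ⊗ x'2) =
    \sw_(x1, x2 <- ΔH x) \sw_(x'1, x'2 <- ΔH x')
      σ (x1 ⊗ x'1) * ((x2 * x'2) ▷ a)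
}.
End Left.

Section Right.
Variables (B : algType K) (ract : {linear (B ⊗ H)%type -> B}).
Variable (τ : {linear (H ⊗ H)%type -> B}).
Local Notation "b ◁ x" := (ract (b ⊗ x)) (at level 39, left associativity).

Record is_right_weak_action : Prop := {
  ract_mul : forall b b' x,
    (b * b') ◁ x = \sw_(x1, x2 <- ΔH x) (b ◁ x1) * (b' ◁ x2);
  ract_one : forall x, 1 ◁ x = εH x *: 1;
  ract_id : forall b, b ◁ 1 = b
}.

Record is_right_crossed_product : Prop := {
  rcross_norm : forall x,
    τ (x ⊗ 1) = εH x *: 1 /\ τ (1 ⊗ x) = εH x *: 1;
  rcross_cocycle : forall x x' x'',
    \sw_(x1, x2 <- ΔH x) \sw_(x'1, x'2 <- ΔH x') \sw_(x''1, x''2 <- ΔH x'')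
      τ (x1 * x'1 ⊗ x''1) * (τ (x2 ⊗ x'2) ◁ x''2) =
    \sw_(x'1, x'2 <- ΔH x') \sw_(x''1, x''2 <- ΔH x'')
      τ (x ⊗ x'1 * x''1) * τ (x'2 ⊗ x''2);
  rcross_twisted : forall x' x'' b,
    \sw_(x'1, x'2 <- ΔH x') \sw_(x''1, x''2 <- ΔH x'')
      τ (x'1 ⊗ x''1) * ((b ◁ x'2) ◁ x''2) =
    \sw_(x'1, x'2 <- ΔH x') \sw_(x''1, x''2 <- ΔH x'')
      (b ◁ (x'1 * x''1)) * τ (x'2 ⊗ x''2)
}.
End Right.

End OneSided.

Section TwoSided.
Variables (K : fieldType) (H A B : algType K).
Variables (ΔH : H -> (H ⊗ H)%type) (εH : H -> K).
Variables (ΔA : A -> (A ⊗ A)%type) (εA : A -> K) (ρA : A -> (H ⊗ A)%type).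
Variables (ΔB : B -> (B ⊗ B)%type) (εB : B -> K) (ρB : B -> (B ⊗ H)%type).
Variables (lact : {linear (H ⊗ A)%type -> A}) (ract : {linear (B ⊗ H)%type -> B}).
Variables (σ : {linear (H ⊗ H)%type -> A}) (τ : {linear (H ⊗ H)%type -> B}).
Local Notation "x ▷ a" := (lact (x ⊗ a)) (at level 39, left associativity).
Local Notation "b ◁ x" := (ract (b ⊗ x)) (at level 39, left associativity).

Definition two_sided_one : (A ⊗ H ⊗ B)%type := 1 ⊗ 1 ⊗ 1.

Definition two_sided_crossed_mul (u v : (A ⊗ H ⊗ B)%type) : (A ⊗ H ⊗ B)%type :=
  \sw_(a, x, b <- u) \sw_(a', x', b' <- v)
  \sw_(x1, x2, x3, x4 <- comul4 ΔH x) \sw_(x'1, x'2, x'3, x'4 <- comul4 ΔH x')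
    a * (x1 ▷ a') * σ (x2 ⊗ x'1) ⊗ x3 * x'2 ⊗ τ (x4 ⊗ x'3) * (b ◁ x'4) * b'.

Definition two_sided_smash_comul (u : (A ⊗ H ⊗ B)%type) :
    ((A ⊗ H ⊗ B) ⊗ (A ⊗ H ⊗ B))%type :=
  \sw_(a, x, b <- u) \sw_(a1, a2 <- ΔA a) \sw_(a2m, a2z <- ρA a2)
  \sw_(x1, x2 <- ΔH x) \sw_(b1, b2 <- ΔB b) \sw_(b1z, b1p <- ρB b1)
    (a1 ⊗ a2m * x1 ⊗ b1z) ⊗ (a2z ⊗ x2 * b1p ⊗ b2).

Definition two_sided_smash_counit (u : (A ⊗ H ⊗ B)%type) : K :=
  \sw_(a, x, b <- u) εA a * εH x * εB b.

(* Indices: m, z encode (-1), (0) for ρA, and z, p encode [0], [1] for ρB, so that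
   a2m1 is a_{2(-1)1}, a2z is a_{2(0)}, b1z is b_{1[0]}, b1p2 is b_{1[1]2}. *)
Record two_sided_conditions : Prop := {
  condC1 : (εA 1 = 1 /\ forall a a', εA (a * a') = εA a * εA a') /\
           (εB 1 = 1 /\ forall b b', εB (b * b') = εB b * εB b');
  condC2 : ΔA 1 = 1 ⊗ 1 /\ ΔB 1 = 1 ⊗ 1;
  condC3 : ρA 1 = 1 ⊗ 1 /\ ρB 1 = 1 ⊗ 1;
  condC4 : (forall x a, εA (x ▷ a) = εA a * εH x) /\
           (forall b x, εB (b ◁ x) = εB b * εH x);
  condC5 : forall a x,
    \sw_(a1, a2 <- ΔA a) \sw_(a2m, a2z <- ρA a2) a1 ⊗ a2m * x ⊗ a2z =
    \sw_(a1, a2 <- ΔA a) \sw_(a2m, a2z <- ρA a2)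
    \sw_(a2m1, a2m2 <- ΔH a2m) \sw_(x1, x2 <- ΔH x)
      a1 * σ (a2m1 ⊗ x1) ⊗ a2m2 * x2 ⊗ a2z;
  condC6 : forall b x,
    \sw_(b1, b2 <- ΔB b) \sw_(b1z, b1p <- ρB b1) b1z ⊗ x * b1p ⊗ b2 =
    \sw_(b1, b2 <- ΔB b) \sw_(b1z, b1p <- ρB b1)
    \sw_(b1p1, b1p2 <- ΔH b1p) \sw_(x1, x2 <- ΔH x)
      b1z ⊗ x1 * b1p1 ⊗ τ (x2 ⊗ b1p2) * b2;
  condD7 : forall a a',
    ΔA (a * a') =
    \sw_(a1, a2 <- ΔA a) \sw_(a2m, a2z <- ρA a2) \sw_(a2m1, a2m2 <- ΔH a2m)
    \sw_(a'1, a'2 <- ΔA a') \sw_(a'2m, a'2z <- ρA a'2)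
      a1 * (a2m1 ▷ a'1) * σ (a2m2 ⊗ a'2m) ⊗ a2z * a'2z;
  condD8 : forall a a',
    ρA (a * a') =
    \sw_(am, az <- ρA a) \sw_(a'm, a'z <- ρA a') am * a'm ⊗ az * a'z;
  condD9 : forall b b',
    ΔB (b * b') =
    \sw_(b1, b2 <- ΔB b) \sw_(b1z, b1p <- ρB b1)
    \sw_(b'1, b'2 <- ΔB b') \sw_(b'1z, b'1p <- ρB b'1)
    \sw_(b'1p1, b'1p2 <- ΔH b'1p)
      b1z * b'1z ⊗ τ (b1p ⊗ b'1p1) * (b2 ◁ b'1p2) * b'2;
  condD10 : forall b b',
    ρB (b * b') =
    \sw_(bz, bp <- ρB b) \sw_(b'z, b'p <- ρB b') bz * b'z ⊗ bp * b'p;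
  condD11 : forall x x',
    \sw_(x1, x2 <- ΔH x) \sw_(x'1, x'2 <- ΔH x')
    \sw_(sm, sz <- ρA (σ (x1 ⊗ x'1))) sm * x2 * x'2 ⊗ sz =
    \sw_(x1, x2 <- ΔH x) \sw_(x'1, x'2 <- ΔH x') x1 * x'1 ⊗ σ (x2 ⊗ x'2);
  condD12 : forall x x',
    ΔA (σ (x ⊗ x')) =
    \sw_(x1, x2 <- ΔH x) \sw_(x'1, x'2 <- ΔH x') σ (x1 ⊗ x'1) ⊗ σ (x2 ⊗ x'2);
  condD13 : forall x x',
    \sw_(x1, x2 <- ΔH x) \sw_(x'1, x'2 <- ΔH x')
    \sw_(tz, tp <- ρB (τ (x2 ⊗ x'2))) tz ⊗ x1 * x'1 * tp =
    \sw_(x1, x2 <- ΔH x) \sw_(x'1, x'2 <- ΔH x') τ (x1 ⊗ x'1) ⊗ x2 * x'2;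
  condD14 : forall x x',
    ΔB (τ (x ⊗ x')) =
    \sw_(x1, x2 <- ΔH x) \sw_(x'1, x'2 <- ΔH x') τ (x1 ⊗ x'1) ⊗ τ (x2 ⊗ x'2);
  condD15 : forall x a,
    ΔA (x ▷ a) =
    \sw_(x1, x2, x3 <- comul3 ΔH x)
    \sw_(a1, a2 <- ΔA a) \sw_(a2m, a2z <- ρA a2)
      (x1 ▷ a1) * σ (x2 ⊗ a2m) ⊗ (x3 ▷ a2z);
  condD16 : forall x a,
    \sw_(x1, x2 <- ΔH x) \sw_(cm, cz <- ρA (x1 ▷ a)) cm * x2 ⊗ cz =
    \sw_(x1, x2 <- ΔH x) \sw_(am, az <- ρA a) x1 * am ⊗ (x2 ▷ az);
  condD17 : forall b x,
    \sw_(x1, x2 <- ΔH x) \sw_(cz, cp <- ρB (b ◁ x2)) cz ⊗ x1 * cp =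
    \sw_(x1, x2 <- ΔH x) \sw_(bz, bp <- ρB b) (bz ◁ x1) ⊗ bp * x2;
  condD18 : forall b x,
    ΔB (b ◁ x) =
    \sw_(b1, b2 <- ΔB b) \sw_(b1z, b1p <- ρB b1)
    \sw_(x1, x2, x3 <- comul3 ΔH x)
      (b1z ◁ x1) ⊗ τ (b1p ⊗ x2) * (b2 ◁ x3);
  condD19 : forall a x,
    \sw_(am, az <- ρA a) am * x ⊗ (1 : B) ⊗ az =
    \sw_(am, az <- ρA a) \sw_(am1, am2 <- ΔH am) \sw_(x1, x2 <- ΔH x)
      am1 * x1 ⊗ τ (am2 ⊗ x2) ⊗ az;
  condD20 : forall b x,
    \sw_(bz, bp <- ρB b) bz ⊗ (1 : A) ⊗ x * bp =
    \sw_(bz, bp <- ρB b) \sw_(x1, x2 <- ΔH x) \sw_(bp1, bp2 <- ΔH bp)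
      bz ⊗ σ (x1 ⊗ bp1) ⊗ x2 * bp2;
  condD21 : forall a b,
    \sw_(am, az <- ρA a) \sw_(bz, bp <- ρB b) (bp ▷ az) ⊗ (bz ◁ am) = a ⊗ b;
  condD22 : forall a a' b b' x x',
    \sw_(x1, x2, x3 <- comul3 ΔH x) \sw_(x'1, x'2, x'3 <- comul3 ΔH x')
      τ (x3 ⊗ x'2) * (b ◁ x'3) * b' ⊗ a * (x1 ▷ a') * σ (x2 ⊗ x'1) =
    \sw_(am, az <- ρA a) \sw_(a'm, a'z <- ρA a')
    \sw_(bz, bp <- ρB b) \sw_(b'z, b'p <- ρB b')
    \sw_(x1, x2, x3 <- comul3 ΔH x) \sw_(x'1, x'2, x'3 <- comul3 ΔH x')
      τ (am * x1 ⊗ a'm * x'1) * (bz ◁ x'2) * b'z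
      ⊗ az * (x2 ▷ a'z) * σ (x3 * bp ⊗ x'3 * b'p)
}.

End TwoSided.

(* Main.v *)
Require Import Defs.
From HB Require Import structures.
From mathcomp Require Import all_boot all_algebra.

Set Implicit Arguments.
Unset Strict Implicit.
Unset Printing Implicit Defensive.

Import GRing.Theory.
Local Open Scope ring_scope.

(** Write P for A ⊗ H ⊗ B with the crossed multiplication and the smash
    comultiplication Δ.  P is always an algebra (the two cocycle conditions and
    the two twisted module conditions), and always a coalgebra (A and B are
    comodule coalgebras and H is a bialgebra); these are [P_algebra] and
    [P_coalgebra].  What has to be compared with the list of conditions is the
    compatibility of the two structures.

    Necessity ([conditions_necessary]).  The identity Δ(uv) = Δ(u)Δ(v) lives in
    six tensor factors.  For u and v taken in A, H or B, each condition is this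
    identity after four, sometimes three, of the factors are killed by their
    counits; this is legitimate once εA and εB are known to be multiplicative
    and compatible with the actions, which comes from ε(uv) = ε(u)ε(v).  Only
    [condD22] needs arbitrary u and v.  It comes out in a form where a coaction
    component multiplies an element that acts, as in x b_[1] ▷ a_(0); by [condD19],
    [condD20] and the twisted module conditions such a product acts as two
    successive actions on the terms concerned, and then [condD21] cancels the
    coactions against the actions ([sw_lact_ract_mul]).

    Sufficiency ([P_bialgebra]).  The pairs (u, v) with Δ(uv) = Δ(u)Δ(v) satisfy
    a two out of three rule: if (u, v) and (v, w) are such pairs then (uv, w) is
    one if and only if (u, vw) is one, by associativity of P and of P ⊗ P.
    Since every element of P is a sum of products a·x·b, it is enough to treat
    the pairs of elements of A, H and B, and the pairs (a·x, b); this is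
    [multiplicative_generators].  Each of these few identities is a short
    computation from the conditions.  The instances of [condD22] used there are
      τ(x_1, a_(-1)) ⊗ x_2 ▷ a_(0) = 1 ⊗ x ▷ a
    with its mirror image, and the exchange of σ(x_1,x'_1) and τ(x_2,x'_2).

    The computations are carried out in Sweedler notation.  A Sweedler sum is a
    finite sum over a chosen decomposition of a tensor, so sums over independent
    tensors may be exchanged, while every other rule of the Sweedler calculus is
    valid for summands that are linear in each bound variable.  The tactics of
    the second part bring nested sums to a normal form and discharge these
    linearity conditions; the proofs then only name the rule that is applied and
    the variables that it is applied to. *)

(** * Linear maps and Sweedler sums *)

Section Linear.
Variable K : fieldType.
Implicit Types V W X Z : lmodType K.

(** [linear] is kept behind a name that does not unfold, so that the tactic [lin]
    below can recurse on the shape of the map. *)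
Definition lin V Z (f : V -> Z) : Prop := linear f.
Definition bilin V W Z (f : V -> W -> Z) : Prop :=
  (forall w, lin (f^~ w)) /\ (forall v, lin (f v)).

Definition trilin V W X Z (f : V -> W -> X -> Z) : Prop :=
  [/\ forall w x, lin (fun v => f v w x), forall v x, lin (fun w => f v w x)
    & forall v w, lin (f v w)].

Lemma bilinP V W Z (f : V -> W -> Z) : bilin f -> bilinear_for *:%R *:%R f.
Proof. by case=> fl fr; split=> [w k u v|v k u w]; [exact: fl|exact: fr]. Qed.

Lemma linD V Z (f : V -> Z) u v : lin f -> f (u + v) = f u + f v.
Proof. by move=> fl; have := fl 1 u v; rewrite !scale1r. Qed.

Lemma lin0 V Z (f : V -> Z) : lin f -> f 0 = 0.
Proof. by move=> fl; apply: (addrI (f 0)); rewrite -(linD 0 0 fl) !addr0. Qed.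

Lemma linZ V Z (f : V -> Z) k v : lin f -> f (k *: v) = k *: f v.
Proof. by move=> fl; have := fl k v 0; rewrite (lin0 fl) !addr0. Qed.

Lemma lin_id V : lin (fun v : V => v).
Proof. by []. Qed.

Lemma lin_comp V W Z (f : W -> Z) (a : V -> W) :
  lin f -> lin a -> lin (fun v => f (a v)).
Proof. by move=> fl al k u v; rewrite al fl. Qed.

Lemma lin_linear V Z (f : {linear V -> Z}) : lin f.
Proof. by move=> k u v; rewrite linearP. Qed.

Lemma lin_tensl V W X (a : V -> W) (w : X) : lin a -> lin (fun v => a v ⊗ w).
Proof. by move=> al k u v; rewrite al (pure_tensor_bilinear W X).1. Qed.

Lemma lin_tensr V W X (a : V -> X) (w : W) : lin a -> lin (fun v => w ⊗ a v).
Proof. by move=> al k u v; rewrite al (pure_tensor_bilinear W X).2. Qed.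

Lemma lin_mull V (A : algType K) (a : V -> A) w : lin a -> lin (fun v => a v * w).
Proof. by move=> al k u v; rewrite al mulrDl scalerAl. Qed.

Lemma lin_mulr V (A : algType K) (a : V -> A) w : lin a -> lin (fun v => w * a v).
Proof. by move=> al k u v; rewrite al mulrDr scalerAr. Qed.

Lemma lin_scalel V Z (a : V -> K^o) (w : Z) :
  lin a -> lin (fun v => (a v : K) *: w).
Proof. by move=> al k u v; rewrite al scalerDl scalerA. Qed.

Lemma lin_scaler V Z (a : V -> Z) (l : K) : lin a -> lin (fun v => l *: a v).
Proof. by move=> al k u v; rewrite al scalerDr !scalerA mulrC. Qed.

Lemma lin_sweedler V W X Z (t : (W ⊗ X)%type) (f : V -> W -> X -> Z) :
  (forall x y, lin (fun v => f v x y)) -> lin (fun v => sweedler t (f v)).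
Proof.
move=> fl k u v; rewrite /sweedler scaler_sumr -big_split.
by apply: eq_bigr => p _; rewrite fl.
Qed.

Lemma lin_sweedler_tensor V W X Z (t : V -> (W ⊗ X)%type) (f : W -> X -> Z) :
  lin t -> bilin f -> lin (fun v => sweedler (t v) f).
Proof.
by move=> tl /bilinP fb k u v; rewrite tl (sweedler_linear fb).
Qed.

Lemma sw_eq V W (Z : nmodType) (t : (V ⊗ W)%type) (f g : V -> W -> Z) :
  (forall x y, f x y = g x y) -> sweedler t f = sweedler t g.
Proof. by move=> fg; apply: eq_bigr. Qed.

Lemma sw_exchange V W V' W' (Z : nmodType) (u : (V ⊗ W)%type) (t : (V' ⊗ W')%type)
    (f : V -> W -> V' -> W' -> Z) :
  sweedler u (fun x y => sweedler t (fun z w => f x y z w)) =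
  sweedler t (fun z w => sweedler u (fun x y => f x y z w)).
Proof. exact: exchange_big. Qed.

Lemma sw_pull V W X Z (c : X -> Z) (t : (V ⊗ W)%type) (f : V -> W -> X) :
  lin c -> c (sweedler t f) = sweedler t (fun x y => c (f x y)).
Proof.
move=> cl; rewrite /sweedler; elim: (repr t) => [|p s IHs].
  by rewrite !big_nil lin0.
by rewrite !big_cons linD // IHs.
Qed.

(** The [step_] lemmas replace the left-hand side of an equation whose right-hand
    side is in general still a metavariable: a chain of them computes a normal
    form, which the metavariable receives when the chain stops. *)
Lemma step_pure V W Z (v : V) (w : W) (f : V -> W -> Z) (e : Z) :
  bilin f -> f v w = e -> sweedler (v ⊗ w) f = e.
Proof. by move=> /bilinP fb <-; rewrite sweedler_pure. Qed.

Lemma step_pull V W X Z (c : X -> Z) (t : (V ⊗ W)%type) (f : V -> W -> X) (e : Z) :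
  lin c -> sweedler t (fun x y => c (f x y)) = e -> c (sweedler t f) = e.
Proof. by move=> cl <-; rewrite sw_pull. Qed.

Lemma step_scale X Z (c : X -> Z) k v e :
  lin c -> k *: c v = e -> c (k *: v) = e.
Proof. by move=> cl <-; rewrite linZ. Qed.

Lemma step_eq (T Z : Type) (c : T -> Z) (t u : T) e : t = u -> c u = e -> c t = e.
Proof. by move=> ->. Qed.

Lemma sw_bring_under V W V' W' (Z : nmodType) (u : (V ⊗ W)%type) (t : (V' ⊗ W')%type)
    (f : V -> W -> Z) (g : V -> W -> V' -> W' -> Z) :
  (forall x y, f x y = sweedler t (g x y)) ->
  sweedler u f = sweedler t (fun z w => sweedler u (fun x y => g x y z w)).
Proof. by move=> fg; rewrite -sw_exchange; apply: sw_eq. Qed.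

Lemma tensor_ext V W Z (f g : (V ⊗ W)%type -> Z) :
  lin f -> lin g -> (forall v w, f (v ⊗ w) = g (v ⊗ w)) -> f =1 g.
Proof.
move=> fl gl fg t; rewrite (tensorE t) !sw_pull //.
by apply: sw_eq => v w; rewrite fg.
Qed.

End Linear.

(** * Tactics for the Sweedler calculus *)

Create HintDb lindb.
Ltac lin_atom := solve [ assumption | apply: lin_linear | auto with lindb nocore ].

(** Proves linearity by following the unique path from the top of the expression to
    the bound variable.  When the path enters the tensor over which a sum ranges,
    the summand must be bilinear, and the tactic restarts on its two variables. *)
Ltac lin :=
  cbv beta;
  lazymatch goal with
  | |- forall _, _ => intro; lin
  | |- bilin _ => split; intro; cbv beta; lin
  | |- trilin _ => split; lin
  | |- lin (fun v => v) => apply: lin_id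
  | |- @lin ?K ?V ?Z (fun v => @sweedler _ ?W ?X _ (@?t v) (@?f v)) =>
      lazymatch t with
      | fun _ => ?u =>
          apply: (@lin_sweedler K V W X Z u f); do 2 intro; lin
      | _ => lazymatch f with
             | fun _ => ?g => apply: (@lin_sweedler_tensor K V W X Z t g); lin
             end
      end
  | |- @lin ?K ?V _ (fun v => @pure_tensor _ ?W ?X (@?a v) (@?b v)) =>
      lazymatch b with
      | fun _ => ?w => apply: (@lin_tensl K V W X a w); lin
      | _ => lazymatch a with
             | fun _ => ?w => apply: (@lin_tensr K V W X b w); lin
             end
      end
  | |- @lin ?K ?V _ (fun v => GRing.mul (@?a v) (@?b v)) =>
      lazymatch b with
      | fun _ => ?w => apply: (@lin_mull K V _ a w); lin
      | _ => lazymatch a with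
             | fun _ => ?w => apply: (@lin_mulr K V _ b w); lin
             end
      end
  | |- @lin ?K ?V ?Z (fun v => GRing.scale (@?a v) (@?b v)) =>
      lazymatch b with
      | fun _ => ?w => apply: (@lin_scalel K V Z a w); lin
      | _ => lazymatch a with
             | fun _ => ?w => apply: (@lin_scaler K V Z b w); lin
             end
      end
  | |- _ =>
      first
      [ lin_atom
      | match goal with
        | |- @lin _ _ ?Z (fun v => ?f (@?a v)) =>
            apply: (@lin_comp _ _ _ Z f a); [lin_atom | lin]
        | |- lin (fun v => ?f (@?a v) ?b) =>
            apply: (lin_comp (f := fun z => f z b) (a := a)); [lin_atom | lin]
        | |- lin (fun v => ?f (@?a v) ?b ?c) =>
            apply: (lin_comp (f := fun z => f z b c) (a := a)); [lin_atom | lin]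
        | |- @lin _ ?V _ ?f =>
            lazymatch f with
            | fun _ => _ => fail
            | _ => change (lin (fun v : V => f v)); lin
            end
        end ]
  end.

(** Q is the linearity condition of the rule l = r; it can be stated only after
    the comparison of L with l has determined the summand. *)
Lemma rw_step (T : Type) (Q : Prop) (l r L R : T) :
  (Q -> l = r) -> L = l -> Q -> r = R -> L = R.
Proof. by move=> lr -> /lr ->. Qed.

Lemma rw_step_rev (T : Type) (Q : Prop) (l r L R : T) :
  (Q -> l = r) -> L = r -> Q -> l = R -> L = R.
Proof. by move=> lr -> /lr <-. Qed.

Section Rules.
Variable K : fieldType.
Implicit Types V W X Z : lmodType K.

Lemma step_under V W (Z : nmodType) (t : (V ⊗ W)%type) (f g : V -> W -> Z) e :
  (forall x y, f x y = g x y) -> sweedler t g = e -> sweedler t f = e.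
Proof. by move=> fg <-; apply: sw_eq. Qed.

Lemma sw_scale V W Z (t : (V ⊗ W)%type) k (f : V -> W -> Z) :
  k *: sweedler t f = \sw_(x, y <- t) k *: f x y.
Proof. by rewrite /sweedler scaler_sumr. Qed.

Lemma pull_scalar V W Z (t : (V ⊗ W)%type) k (f g : V -> W -> Z) :
  (forall x y, f x y = k *: g x y) -> sweedler t f = k *: sweedler t g.
Proof. by move=> fg; rewrite /sweedler scaler_sumr; apply: eq_bigr. Qed.

Lemma sw3_congr V W X Z (f : V -> W -> X -> Z) (t u : (V ⊗ W ⊗ X)%type) x y:
  t = u -> \sw_(a, b, c <- t) f a b c = x -> \sw_(a, b, c <- u) f a b c = y -> x = y.
Proof. by move=> -> <-. Qed.

Lemma sw2_congr V W Z (f : V -> W -> Z) (t u : (V ⊗ W)%type) x y: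
  t = u -> \sw_(a, b <- t) f a b = x -> \sw_(a, b <- u) f a b = y -> x = y.
Proof. by move=> -> <-. Qed.

Lemma apply_congr V Z (f : V -> Z) (t u : V) x y:
  t = u -> f t = x -> f u = y -> x = y.
Proof. by move=> -> <-. Qed.
End Rules.

(** Simplification rules, which depend on the structures at hand and are given with
    them: the first hook rewrites the tensor over which the leading sum ranges, the
    second one rewrites a summand without sums. *)
Ltac sw_tensor_hook := fail.
Ltac sw_leaf_hook := fail.

(** On a goal L = e: pulls all the sums in L to the front, so that L becomes a
    prefix of sums followed by a product of elements. *)
Ltac sw_flat :=
  cbv beta;
  lazymatch goal with
  | |- sweedler (pure_tensor ?v ?w) ?f = _ =>
      apply: (@step_pure _ _ _ _ v w f); [lin | sw_flat]
  | |- sweedler ?t ?f = _ =>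
      lazymatch t with
      | context [@sweedler ?K ?V ?W ?Z ?u ?g] =>
          let L := lazymatch goal with |- ?L = _ => L end in
          lazymatch (eval pattern (@sweedler K V W Z u g) in L) with
          | ?c _ => apply: (@step_pull _ _ _ _ _ c u g); [lin | sw_flat]
          end
      | _ => tryif sw_tensor_hook then sw_flat else (apply: sw_eq; do 2 intro; sw_flat)
      end
  | |- ?L = _ =>
      lazymatch L with
      | context [@sweedler ?K ?V ?W ?Z ?u ?g] =>
          lazymatch (eval pattern (@sweedler K V W Z u g) in L) with
          | ?c _ => apply: (@step_pull _ _ _ _ _ c u g); [lin | sw_flat]
          end
      | _ => tryif sw_leaf_hook then sw_flat else reflexivity
      end
  end.

(** On a goal L = sweedler t ?g: exchanges sums until the one over t is leading. *)
Ltac sw_bring :=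
  cbv beta;
  lazymatch goal with
  | |- @sweedler _ _ _ _ ?t _ = @sweedler _ _ _ _ ?t _ => reflexivity
  | |- @sweedler _ _ _ _ ?u _ = @sweedler _ _ _ _ ?t _ =>
      apply: sw_bring_under; do 2 intro; sw_bring
  end.

Ltac sw_bring_to t :=
  lazymatch goal with
  | |- _ = _ => refine (_ : _ = @sweedler _ _ _ _ t _); sw_bring
  end.

(** On a goal L = R: equality up to the order of the sums.  The summand on the right
    may be an unknown function applied to given elements; it is then obtained from
    the summand on the left by abstracting these elements, which is how the rules
    of the calculus are instantiated.  A product to be abstracted is first
    isolated by associativity. *)
Ltac sw_assoc a :=
  lazymatch a with
  | GRing.mul ?u ?v => try rewrite -(mulrA _ u v)
  | _ => idtac
  end.

Ltac sw_leaf :=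
  lazymatch goal with
  | |- ?L = ?R =>
    first
    [ reflexivity
    | lazymatch R with
      | ?f ?a ?b ?c => is_evar f; sw_assoc a; sw_assoc b; sw_assoc c;
          let L := lazymatch goal with |- ?L = _ => L end in
          lazymatch (eval pattern a, b, c in L) with
          | ?g _ _ _ => unify f g; reflexivity
          end
      end
    | lazymatch R with
      | ?f ?a ?b => is_evar f; sw_assoc a; sw_assoc b;
          let L := lazymatch goal with |- ?L = _ => L end in
          lazymatch (eval pattern a, b in L) with
          | ?g _ _ => unify f g; reflexivity
          end
      end
    | lazymatch R with
      | ?f ?a => is_evar f; sw_assoc a;
          let L := lazymatch goal with |- ?L = _ => L end in
          lazymatch (eval pattern a in L) with
          | ?g _ => unify f g; reflexivity
          end
      end
    ]
  end.

Ltac sw_match :=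
  cbv beta;
  lazymatch goal with
  | |- _ = @sweedler _ _ _ _ ?t _ =>
      etransitivity; [ sw_bring_to t | apply: sw_eq; do 2 intro; sw_match ]
  | |- _ => sw_leaf
  end.

(** On a goal L = k *: ?g: moves the scalar k to the front of L. *)
Ltac sw_scalar :=
  cbv beta;
  lazymatch goal with
  | |- ?L = ?k *: _ =>
    lazymatch L with
    | GRing.scale k _ => reflexivity
    | context [@GRing.scale ?R ?M k ?v] =>
        lazymatch (eval pattern (@GRing.scale R M k v) in L) with
        | ?c _ => apply: (@linZ _ _ _ c k v); lin
        end
    | sweedler _ _ => apply: pull_scalar; do 2 intro; sw_scalar
    end
  end.

(** The coalgebraic rules for a leading sum over t, again given with the structures. *)
Ltac sw_rule t := fail.

(** Applies a counit rule.  Naming the value of the counit makes it a scalar that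
    can be moved out of the remaining sums. *)
Tactic Notation "sw_counit" uconstr(E) :=
  refine E; [ let k := fresh in let Hk := fresh in
              intros ? ? k Hk; cbv beta;
              lazymatch type of Hk with
              | _ = ?u => lazymatch goal with
                          | |- ?L = _ => lazymatch L with context [u] => idtac end end
              end;
              rewrite <- Hk; clear Hk; sw_scalar
            | lin | ].

(** Applies a rule about two nested coproducts or coactions, once the inner sum has
    been brought next to the outer one. *)
Tactic Notation "sw_nested" uconstr(E) := refine E; [ do 2 intro; cbv beta;
              lazymatch goal with
              | |- ?L = sweedler ?t _ => lazymatch L with context [t] => sw_bring end
              end
            | lin | ].

(** Works from the inside out, because an inner rule can make an outer one
    applicable; when a rule fires, everything below it is normalised again. *)
Ltac sw_comb :=
  cbv beta;
  lazymatch goal with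
  | |- sweedler ?t _ = _ =>
      eapply step_under;
      [ do 2 intro; sw_comb
      | cbv beta;
        tryif sw_rule t then (etransitivity; [sw_flat | sw_comb]) else reflexivity ]
  | |- _ => reflexivity
  end.

Ltac sw_has u :=
  lazymatch goal with
  | |- ?L = _ => lazymatch L with context [u] => idtac end
  end.

Ltac sw_norm := etransitivity; [sw_flat | sw_comb].

(** One and the same structure on an algebra can be inferred along several paths,
    giving terms that are convertible but not identical; sums are compared
    syntactically, so these paths are first made equal. *)
Ltac sw_clean :=
  cbv beta delta [reverse_coercion];
  repeat match goal with
  | |- context [GRing.Lalgebra.Exports.join_GRing_Lalgebra_between_GRing_Lmodule_and_GRing_PzSemiRing
                  (@GRing.Algebra.Exports.GRing_Algebra__to__GRing_Lalgebra ?R ?X)] =>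
      change (GRing.Lalgebra.Exports.join_GRing_Lalgebra_between_GRing_Lmodule_and_GRing_PzSemiRing
                (@GRing.Algebra.Exports.GRing_Algebra__to__GRing_Lalgebra R X))
        with (@GRing.Algebra.Exports.GRing_Algebra__to__GRing_PzSemiRing R X)
  | |- context [@GRing.Lalgebra.Exports.GRing_Lalgebra__to__GRing_Lmodule _
                  (@GRing.Algebra.Exports.GRing_Algebra__to__GRing_Lalgebra ?R ?X)] =>
      change (@GRing.Lalgebra.Exports.GRing_Lalgebra__to__GRing_Lmodule R
                (@GRing.Algebra.Exports.GRing_Algebra__to__GRing_Lalgebra R X))
        with (@GRing.Algebra.Exports.GRing_Algebra__to__GRing_Lmodule R X)
  end.

(** Rewrites the left-hand side by the rule E, [sw_rwr] from right to left.  The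
    summand of E is found by matching its sums with those of the left-hand side;
    only then can its linearity be checked. *)
Tactic Notation "sw_rw" uconstr(E) :=
  eapply (rw_step E); [ sw_clean; sw_match | lin | cbv beta ].
Tactic Notation "sw_rwr" uconstr(E) :=
  eapply (rw_step_rev E); [ sw_clean; sw_match | lin | cbv beta ].

(** Reduces an equation to the terms of a sum over t that occurs on both sides. *)
Tactic Notation "sw_strip" constr(t) "=>" ident(x) ident(y) :=
  etransitivity; [ sw_bring_to t | ]; symmetry;
  etransitivity; [ sw_bring_to t | ]; symmetry;
  apply: sw_eq => x y; cbv beta.

(** Rewrites the left-hand side under the sum over t. *)
Tactic Notation "sw_in" constr(t) "=>" ident(x) ident(y) ":" tactic3(tac) :=
  etransitivity; [ sw_bring_to t | ];
  eapply step_under; [ intros x y; cbv beta; tac; reflexivity | cbv beta ].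

Ltac sw_simpl := sw_clean; etransitivity; [ sw_norm | sw_clean ].
Ltac sw_auto := sw_simpl; symmetry; sw_simpl; symmetry.

(** * Rules for coalgebras and comodule coalgebras *)

Section Coalgebra.
Variables (K : fieldType) (V : lmodType K) (Δ : V -> (V ⊗ V)%type) (ε : V -> K).
Hypothesis C : is_coalgebra Δ ε.
Variable Z : lmodType K.

Let Δ_lin : lin Δ := coalg_Δ_linear C.
Let ε_lin : lin (ε : V -> K^o) := coalg_ε_linear C.
#[local] Hint Resolve Δ_lin ε_lin : lindb.

Lemma coassocE (f : V -> V -> V -> Z) c : trilin f ->
  (\sw_(c1, c2 <- Δ c) \sw_(c11, c12 <- Δ c1) f c11 c12 c2) =
  \sw_(c1, c2 <- Δ c) \sw_(c21, c22 <- Δ c2) f c1 c21 c22.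
Proof.
by case=> *; apply: (sw3_congr (f := f) (coalg_coassoc C c)); sw_flat.
Qed.

Lemma counitlE (f : V -> Z) c : lin f -> (\sw_(c1, c2 <- Δ c) ε c1 *: f c2) = f c.
Proof.
move=> fl; rewrite -{2}(coalg_counitl C c) (sw_pull _ _ fl).
by apply: sw_eq => c1 c2; rewrite (linZ _ _ fl).
Qed.

Lemma counitrE (f : V -> Z) c : lin f -> (\sw_(c1, c2 <- Δ c) ε c2 *: f c1) = f c.
Proof.
move=> fl; rewrite -{2}(coalg_counitr C c) (sw_pull _ _ fl).
by apply: sw_eq => c1 c2; rewrite (linZ _ _ fl).
Qed.

(** Coproducts are normalised by expanding the last factor only. *)
Lemma step_coassoc c (f : V -> V -> Z) (g : V -> V -> V -> Z) (e : Z) :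
  (forall c1 c2, f c1 c2 = \sw_(c11, c12 <- Δ c1) g c11 c12 c2) -> trilin g ->
  (\sw_(c1, c2 <- Δ c) \sw_(c21, c22 <- Δ c2) g c1 c21 c22) = e ->
  sweedler (Δ c) f = e.
Proof. by move=> fg gl <-; rewrite -coassocE //; apply: sw_eq. Qed.

Lemma step_counitl c (f : V -> V -> Z) (g : V -> Z) (e : Z) :
  (forall c1 c2 k, k = ε c1 -> f c1 c2 = k *: g c2) -> lin g ->
  g c = e -> sweedler (Δ c) f = e.
Proof. by move=> fg gl <-; rewrite -counitlE //; apply: sw_eq => *; apply: fg. Qed.

Lemma step_counitr c (f : V -> V -> Z) (g : V -> Z) (e : Z) :
  (forall c1 c2 k, k = ε c2 -> f c1 c2 = k *: g c1) -> lin g ->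
  g c = e -> sweedler (Δ c) f = e.
Proof. by move=> fg gl <-; rewrite -counitrE //; apply: sw_eq => *; apply: fg. Qed.
End Coalgebra.

Section Comodule.
Variables (K : fieldType) (H : algType K) (ΔH : H -> (H ⊗ H)%type) (εH : H -> K).
Variable Z : lmodType K.

Section Left.
Variables (A : lmodType K) (ΔA : A -> (A ⊗ A)%type) (εA : A -> K) (ρ : A -> (H ⊗ A)%type).
Hypothesis C : is_left_comodule_coalgebra ΔH εH ΔA εA ρ.
Let ρ_lin : lin ρ := lcomod_linear (lcc_comodule C).
Let ΔA_lin : lin ΔA := coalg_Δ_linear (lcc_coalgebra C).
Let εA_lin : lin (εA : A -> K^o) := coalg_ε_linear (lcc_coalgebra C).
#[local] Hint Resolve ρ_lin ΔA_lin εA_lin : lindb.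

Lemma lcoassocE (f : H -> H -> A -> Z) a : trilin f ->
  (\sw_(h, a0 <- ρ a) \sw_(h1, h2 <- ΔH h) f h1 h2 a0) =
  \sw_(h, a0 <- ρ a) \sw_(h', a00 <- ρ a0) f h h' a00.
Proof.
by case=> *; apply: (sw3_congr (f := f) (lcomod_coassoc (lcc_comodule C) a)); sw_flat.
Qed.

Lemma lcounitE (f : A -> Z) a : lin f -> (\sw_(h, a0 <- ρ a) εH h *: f a0) = f a.
Proof.
move=> fl; rewrite -{2}(lcomod_counit (lcc_comodule C) a) (sw_pull _ _ fl).
by apply: sw_eq => h a0; rewrite (linZ _ _ fl).
Qed.

Lemma lcc_comulE (f : H -> A -> A -> Z) a : trilin f ->
  (\sw_(h, a0 <- ρ a) \sw_(a01, a02 <- ΔA a0) f h a01 a02) =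
  \sw_(a1, a2 <- ΔA a) \sw_(h1, a10 <- ρ a1) \sw_(h2, a20 <- ρ a2)
    f (h1 * h2) a10 a20.
Proof.
by case=> *; apply: (sw3_congr (f := f) (lcc_comul C a)); sw_flat.
Qed.

Lemma lcc_counitE (f : H -> Z) a : lin f ->
  (\sw_(h, a0 <- ρ a) εA a0 *: f h) = εA a *: f 1.
Proof.
move=> fl; rewrite -(linZ _ _ fl) -(lcc_counit C a) (sw_pull _ _ fl).
by apply: sw_eq => h a0; rewrite (linZ _ _ fl).
Qed.

(** A coproduct of the coacting element is turned into a second coaction. *)
Lemma step_lcoassoc a (f : H -> A -> Z) (g : H -> H -> A -> Z) (e : Z) :
  (forall h a0, f h a0 = \sw_(h1, h2 <- ΔH h) g h1 h2 a0) -> trilin g ->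
  (\sw_(h, a0 <- ρ a) \sw_(h', a00 <- ρ a0) g h h' a00) = e ->
  sweedler (ρ a) f = e.
Proof. by move=> fg gl <-; rewrite -lcoassocE //; apply: sw_eq. Qed.

Lemma step_lcounit a (f : H -> A -> Z) (g : A -> Z) (e : Z) :
  (forall h a0 k, k = εH h -> f h a0 = k *: g a0) -> lin g ->
  g a = e -> sweedler (ρ a) f = e.
Proof. by move=> fg gl <-; rewrite -lcounitE //; apply: sw_eq => *; apply: fg. Qed.

(** A coproduct is moved in front of a coaction. *)
Lemma step_lcc_comul a (f : H -> A -> Z) (g : H -> A -> A -> Z) (e : Z) :
  (forall h a0, f h a0 = \sw_(a1, a2 <- ΔA a0) g h a1 a2) -> trilin g ->
  (\sw_(a1, a2 <- ΔA a) \sw_(h1, a10 <- ρ a1) \sw_(h2, a20 <- ρ a2)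
    g (h1 * h2) a10 a20) = e ->
  sweedler (ρ a) f = e.
Proof. by move=> fg gl <-; rewrite -lcc_comulE //; apply: sw_eq. Qed.

Lemma step_lcc_counit a (f : H -> A -> Z) (g : H -> Z) (e : Z) :
  (forall h a0 k, k = εA a0 -> f h a0 = k *: g h) -> lin g ->
  εA a *: g 1 = e -> sweedler (ρ a) f = e.
Proof. by move=> fg gl <-; rewrite -lcc_counitE //; apply: sw_eq => *; apply: fg. Qed.
End Left.

Section Right.
Variables (B : lmodType K) (ΔB : B -> (B ⊗ B)%type) (εB : B -> K) (ρ : B -> (B ⊗ H)%type).
Hypothesis C : is_right_comodule_coalgebra ΔH εH ΔB εB ρ.
Let ρ_lin : lin ρ := rcomod_linear (rcc_comodule C).
Let ΔB_lin : lin ΔB := coalg_Δ_linear (rcc_coalgebra C).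
Let εB_lin : lin (εB : B -> K^o) := coalg_ε_linear (rcc_coalgebra C).
#[local] Hint Resolve ρ_lin ΔB_lin εB_lin : lindb.

Lemma rcoassocE (f : B -> H -> H -> Z) b : trilin f ->
  (\sw_(b0, h <- ρ b) \sw_(h1, h2 <- ΔH h) f b0 h1 h2) =
  \sw_(b0, h <- ρ b) \sw_(b00, h' <- ρ b0) f b00 h' h.
Proof.
by case=> *; apply: (sw3_congr (f := f) (esym (rcomod_coassoc (rcc_comodule C) b))); sw_flat.
Qed.

Lemma rcounitE (f : B -> Z) b : lin f -> (\sw_(b0, h <- ρ b) εH h *: f b0) = f b.
Proof.
move=> fl; rewrite -{2}(rcomod_counit (rcc_comodule C) b) (sw_pull _ _ fl).
by apply: sw_eq => b0 h; rewrite (linZ _ _ fl).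
Qed.

Lemma rcc_comulE (f : B -> B -> H -> Z) b : trilin f ->
  (\sw_(b0, h <- ρ b) \sw_(b01, b02 <- ΔB b0) f b01 b02 h) =
  \sw_(b1, b2 <- ΔB b) \sw_(b10, h1 <- ρ b1) \sw_(b20, h2 <- ρ b2)
    f b10 b20 (h1 * h2).
Proof.
by case=> *; apply: (sw3_congr (f := f) (rcc_comul C b)); sw_flat.
Qed.

Lemma rcc_counitE (f : H -> Z) b : lin f ->
  (\sw_(b0, h <- ρ b) εB b0 *: f h) = εB b *: f 1.
Proof.
move=> fl; rewrite -(linZ _ _ fl) -(rcc_counit C b) (sw_pull _ _ fl).
by apply: sw_eq => b0 h; rewrite (linZ _ _ fl).
Qed.

Lemma step_rcoassoc b (f : B -> H -> Z) (g : B -> H -> H -> Z) (e : Z) :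
  (forall b0 h, f b0 h = \sw_(h1, h2 <- ΔH h) g b0 h1 h2) -> trilin g ->
  (\sw_(b0, h <- ρ b) \sw_(b00, h' <- ρ b0) g b00 h' h) = e ->
  sweedler (ρ b) f = e.
Proof. by move=> fg gl <-; rewrite -rcoassocE //; apply: sw_eq. Qed.

Lemma step_rcounit b (f : B -> H -> Z) (g : B -> Z) (e : Z) :
  (forall b0 h k, k = εH h -> f b0 h = k *: g b0) -> lin g ->
  g b = e -> sweedler (ρ b) f = e.
Proof. by move=> fg gl <-; rewrite -rcounitE //; apply: sw_eq => *; apply: fg. Qed.

Lemma step_rcc_comul b (f : B -> H -> Z) (g : B -> B -> H -> Z) (e : Z) :
  (forall b0 h, f b0 h = \sw_(b1, b2 <- ΔB b0) g b1 b2 h) -> trilin g ->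
  (\sw_(b1, b2 <- ΔB b) \sw_(b10, h1 <- ρ b1) \sw_(b20, h2 <- ρ b2)
    g b10 b20 (h1 * h2)) = e ->
  sweedler (ρ b) f = e.
Proof. by move=> fg gl <-; rewrite -rcc_comulE //; apply: sw_eq. Qed.

Lemma step_rcc_counit b (f : B -> H -> Z) (g : H -> Z) (e : Z) :
  (forall b0 h k, k = εB b0 -> f b0 h = k *: g h) -> lin g ->
  εB b *: g 1 = e -> sweedler (ρ b) f = e.
Proof. by move=> fg gl <-; rewrite -rcc_counitE //; apply: sw_eq => *; apply: fg. Qed.
End Right.
End Comodule.

(** * The tensor square of an algebra *)

Section TensorMul.
Variables (K : fieldType) (V : lmodType K) (mul : V -> V -> V).
Hypothesis mul_bilin : bilin mul.
Hypothesis mulA : associative mul.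
Let mul_linl v : lin (mul^~ v) := mul_bilin.1 v.
Let mul_linr u : lin (mul u) := mul_bilin.2 u.
#[local] Hint Resolve mul_linl mul_linr : lindb.

Lemma tensor_mul_pure u v u' v' :
  tensor_mul mul (u ⊗ v) (u' ⊗ v') = mul u u' ⊗ mul v v'.
Proof. by rewrite /tensor_mul; sw_flat. Qed.

Lemma tensor_mul_bilin : bilin (tensor_mul mul).
Proof. by rewrite /tensor_mul; lin. Qed.

Lemma tensor_mulA : associative (tensor_mul mul).
Proof.
have [linl linr] := tensor_mul_bilin.
move=> s t u; move: s; apply: tensor_ext; [lin | lin | move=> s1 s2].
move: t; apply: tensor_ext; [lin | lin | move=> t1 t2].
move: u; apply: tensor_ext; [lin | lin | move=> u1 u2].
by rewrite !tensor_mul_pure !mulA.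
Qed.
End TensorMul.

(** * The coalgebra structure *)

Section TwoSided.
Variables (K : fieldType) (H A B : algType K).
Variables (ΔH : H -> (H ⊗ H)%type) (εH : H -> K).
Variables (ΔA : A -> (A ⊗ A)%type) (εA : A -> K) (ρA : A -> (H ⊗ A)%type).
Variables (ΔB : B -> (B ⊗ B)%type) (εB : B -> K) (ρB : B -> (B ⊗ H)%type).
Variables (lact : {linear (H ⊗ A)%type -> A}) (ract : {linear (B ⊗ H)%type -> B}).
Variables (σ : {linear (H ⊗ H)%type -> A}) (τ : {linear (H ⊗ H)%type -> B}).
Hypothesis hH : is_bialgebra *%R 1 ΔH εH.
Hypothesis hA : is_left_comodule_coalgebra ΔH εH ΔA εA ρA.
Hypothesis hB : is_right_comodule_coalgebra ΔH εH ΔB εB ρB.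
Hypothesis wA : is_left_weak_action ΔH εH lact.
Hypothesis wB : is_right_weak_action ΔH εH ract.
Hypothesis εA1 : εA 1 = 1.
Hypothesis εAσ : forall x x', εA (σ (x ⊗ x')) = εH x * εH x'.
Hypothesis εB1 : εB 1 = 1.
Hypothesis εBτ : forall x x', εB (τ (x ⊗ x')) = εH x * εH x'.
Hypothesis xA : is_left_crossed_product ΔH εH lact σ.
Hypothesis xB : is_right_crossed_product ΔH εH ract τ.
Local Notation "x ▷ a" := (lact (x ⊗ a)) (at level 39, left associativity).
Local Notation "b ◁ x" := (ract (b ⊗ x)) (at level 39, left associativity).
Local Notation P := (A ⊗ H ⊗ B)%type.
Local Notation mul := (two_sided_crossed_mul ΔH lact ract σ τ).
Local Notation Δ := (two_sided_smash_comul ΔH ΔA ρA ΔB ρB).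
Local Notation ε := (two_sided_smash_counit εH εA εB).

Let cH : is_coalgebra ΔH εH := bialg_coalgebra hH.
Let cA : is_coalgebra ΔA εA := lcc_coalgebra hA.
Let cB : is_coalgebra ΔB εB := rcc_coalgebra hB.
Let ΔH_lin : lin ΔH := coalg_Δ_linear cH.
Let ΔA_lin : lin ΔA := coalg_Δ_linear cA.
Let ΔB_lin : lin ΔB := coalg_Δ_linear cB.
Let εH_lin : lin (εH : H -> K^o) := coalg_ε_linear cH.
Let εA_lin : lin (εA : A -> K^o) := coalg_ε_linear cA.
Let εB_lin : lin (εB : B -> K^o) := coalg_ε_linear cB.
Let ρA_lin : lin ρA := lcomod_linear (lcc_comodule hA).
Let ρB_lin : lin ρB := rcomod_linear (rcc_comodule hB).
#[local] Hint Resolve ΔH_lin ΔA_lin ΔB_lin εH_lin εA_lin εB_lin ρA_lin ρB_lin : lindb.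

Let ΔHM x y : ΔH (x * y) =
  \sw_(x1, x2 <- ΔH x) \sw_(y1, y2 <- ΔH y) x1 * y1 ⊗ x2 * y2.
Proof. exact: bialg_ΔM hH x y. Qed.
Let ΔH1 : ΔH 1 = 1 ⊗ 1. Proof. exact: bialg_Δ1 hH. Qed.
Let εHM x y : εH (x * y) = εH x * εH y. Proof. exact: bialg_εM hH x y. Qed.
Let εH1 : εH 1 = 1. Proof. exact: bialg_ε1 hH. Qed.

Ltac sw_tensor_hook ::=
  lazymatch goal with
  | |- sweedler (ΔH (?x * ?y)) ?f = _ =>
      apply: (@step_eq _ _ (fun s => sweedler s f) _ _ _ (ΔHM x y))
  | |- sweedler (ΔH 1) ?f = _ =>
      apply: (@step_eq _ _ (fun s => sweedler s f) _ _ _ ΔH1)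
  end.

Let unitE := (mul1r, mulr1, scale1r, εHM, εH1).
Ltac sw_leaf_hook ::= progress rewrite ?unitE ?mulrA -?scalerA.

Ltac sw_rule t ::=
  lazymatch t with
  | ΔH _ => first [ sw_has εH; first [ sw_counit (step_counitl cH _ _ _)
                                  | sw_counit (step_counitr cH _ _ _) ]
                  | sw_nested (step_coassoc cH _ _ _) ]
  | ΔA _ => first [ sw_has εA; first [ sw_counit (step_counitl cA _ _ _)
                                  | sw_counit (step_counitr cA _ _ _) ]
                  | sw_nested (step_coassoc cA _ _ _) ]
  | ΔB _ => first [ sw_has εB; first [ sw_counit (step_counitl cB _ _ _)
                                  | sw_counit (step_counitr cB _ _ _) ]
                  | sw_nested (step_coassoc cB _ _ _) ]
  | ρA _ => first [ sw_has εH; sw_counit (step_lcounit hA _ _ _)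
                  | sw_has εA; sw_counit (step_lcc_counit hA _ _ _)
                  | sw_nested (step_lcoassoc hA _ _ _) | sw_nested (step_lcc_comul hA _ _ _) ]
  | ρB _ => first [ sw_has εH; sw_counit (step_rcounit hB _ _ _)
                  | sw_has εB; sw_counit (step_rcc_counit hB _ _ _)
                  | sw_nested (step_rcoassoc hB _ _ _) | sw_nested (step_rcc_comul hB _ _ _) ]
  end.

Lemma comul_lin : lin Δ.
Proof. by rewrite /two_sided_smash_comul; lin. Qed.

Lemma P_ext (Z : lmodType K) (f g : P -> Z) : lin f -> lin g ->
  (forall a x b, f (a ⊗ x ⊗ b) = g (a ⊗ x ⊗ b)) -> f =1 g.
Proof.
move=> fl gl fg; apply: tensor_ext => // a.
by apply: tensor_ext; [lin | lin | move=> x b; apply: fg].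
Qed.

Lemma comul_coassoc c :
  (\sw_(c1, c2 <- Δ c) \sw_(c11, c12 <- Δ c1) c11 ⊗ c12 ⊗ c2) =
    \sw_(c1, c2 <- Δ c) \sw_(c21, c22 <- Δ c2) c1 ⊗ c21 ⊗ c22.
Proof.
rewrite /two_sided_smash_comul; move: c; apply: P_ext; [lin | lin | move=> a x b].
by sw_auto; sw_match.
Qed.

(** * The algebra structure *)

Lemma mulE a x b a' x' b' :
  mul (a ⊗ x ⊗ b) (a' ⊗ x' ⊗ b') =
  \sw_(x1, y1 <- ΔH x) \sw_(x2, y2 <- ΔH y1) \sw_(x3, x4 <- ΔH y2)
  \sw_(x'1, y'1 <- ΔH x') \sw_(x'2, y'2 <- ΔH y'1) \sw_(x'3, x'4 <- ΔH y'2)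
    a * (x1 ▷ a') * σ (x2 ⊗ x'1) ⊗ x3 * x'2 ⊗ τ (x4 ⊗ x'3) * (b ◁ x'4) * b'.
Proof. by rewrite /two_sided_crossed_mul /comul4 /comul3; sw_flat. Qed.

Lemma mul_bilin : bilin mul.
Proof. by rewrite /two_sided_crossed_mul /comul4 /comul3; lin. Qed.
Let mul_linl v : lin (mul^~ v) := mul_bilin.1 v.
Let mul_linr u : lin (mul u) := mul_bilin.2 u.
#[local] Hint Resolve mul_linl mul_linr : lindb.

Lemma sw_twistedA (Z : lmodType K) (f : A -> Z) x x' a : lin f ->
  (\sw_(x1, x2 <- ΔH x) \sw_(x'1, x'2 <- ΔH x')
     f (σ (x1 ⊗ x'1) * ((x2 * x'2) ▷ a))) =
  \sw_(x1, x2 <- ΔH x) \sw_(x'1, x'2 <- ΔH x')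
     f ((x1 ▷ (x'1 ▷ a)) * σ (x2 ⊗ x'2)).
Proof. by move=> fl; apply: (apply_congr (f := f) (esym (lcross_twisted xA x x' a))); sw_flat. Qed.

Lemma sw_cocycleA (Z : lmodType K) (f : A -> Z) x x' x'' : lin f ->
  (\sw_(x1, x2 <- ΔH x) \sw_(x'1, x'2 <- ΔH x')
     f (σ (x1 ⊗ x'1) * σ (x2 * x'2 ⊗ x''))) =
  \sw_(x1, x2 <- ΔH x) \sw_(x'1, x'2 <- ΔH x') \sw_(x''1, x''2 <- ΔH x'')
     f ((x1 ▷ σ (x'1 ⊗ x''1)) * σ (x2 ⊗ x'2 * x''2)).
Proof. by move=> fl; apply: (apply_congr (f := f) (esym (lcross_cocycle xA x x' x''))); sw_flat. Qed.

Lemma sw_twistedB (Z : lmodType K) (f : B -> Z) x' x'' b : lin f ->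
  (\sw_(x'1, x'2 <- ΔH x') \sw_(x''1, x''2 <- ΔH x'')
     f (τ (x'1 ⊗ x''1) * ((b ◁ x'2) ◁ x''2))) =
  \sw_(x'1, x'2 <- ΔH x') \sw_(x''1, x''2 <- ΔH x'')
     f ((b ◁ (x'1 * x''1)) * τ (x'2 ⊗ x''2)).
Proof. by move=> fl; apply: (apply_congr (f := f) (rcross_twisted xB x' x'' b)); sw_flat. Qed.

Lemma sw_cocycleB (Z : lmodType K) (f : B -> Z) x x' x'' : lin f ->
  (\sw_(x1, x2 <- ΔH x) \sw_(x'1, x'2 <- ΔH x') \sw_(x''1, x''2 <- ΔH x'')
     f (τ (x1 * x'1 ⊗ x''1) * (τ (x2 ⊗ x'2) ◁ x''2))) =
  \sw_(x'1, x'2 <- ΔH x') \sw_(x''1, x''2 <- ΔH x'')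
     f (τ (x ⊗ x'1 * x''1) * τ (x'2 ⊗ x''2)).
Proof. by move=> fl; apply: (apply_congr (f := f) (rcross_cocycle xB x x' x'')); sw_flat. Qed.

Let σx1 x : σ (x ⊗ 1) = εH x *: 1. Proof. exact: (lcross_norm xA x).1. Qed.
Let σ1x x : σ (1 ⊗ x) = εH x *: 1. Proof. exact: (lcross_norm xA x).2. Qed.
Let τx1 x : τ (x ⊗ 1) = εH x *: 1. Proof. exact: (rcross_norm xB x).1. Qed.
Let τ1x x : τ (1 ⊗ x) = εH x *: 1. Proof. exact: (rcross_norm xB x).2. Qed.
Let lact1 x : x ▷ 1 = εH x *: 1. Proof. exact: lact_one wA x. Qed.
Let lact1x a : 1 ▷ a = a. Proof. exact: lact_id wA a. Qed.
Let lactM x a a' : x ▷ (a * a') = \sw_(x1, x2 <- ΔH x) (x1 ▷ a) * (x2 ▷ a').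
Proof. exact: lact_mul wA x a a'. Qed.
Let ract1 x : 1 ◁ x = εH x *: 1. Proof. exact: ract_one wB x. Qed.
Let ract1x b : b ◁ 1 = b. Proof. exact: ract_id wB b. Qed.
Let ractM b b' x : (b * b') ◁ x = \sw_(x1, x2 <- ΔH x) (b ◁ x1) * (b' ◁ x2).
Proof. exact: ract_mul wB b b' x. Qed.

Let crossedE := (σx1, σ1x, τx1, τ1x, lact1, lact1x, ract1, ract1x, unitE).
Ltac sw_leaf_hook ::=
  progress rewrite ?(mulE, crossedE) ?lactM ?ractM ?mulrA -?scalerA.

(** The A-component of associativity, with the components of x, x' and x'' that go
    to the other two factors removed: first the twisted module condition moves the
    action of x x' past σ, then the cocycle condition applies to what is left. *)
Lemma assocA x x' x'' a' a'' :
  (\sw_(x1, y1 <- ΔH x) \sw_(x2, y2 <- ΔH y1) \sw_(x3, x4 <- ΔH y2)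
   \sw_(x'1, y'1 <- ΔH x') \sw_(x'2, x'3 <- ΔH y'1)
    (x1 ▷ a') * σ (x2 ⊗ x'1) * ((x3 * x'2) ▷ a'') * σ (x4 * x'3 ⊗ x'')) =
  \sw_(x1, x2 <- ΔH x) \sw_(x'1, y'1 <- ΔH x') \sw_(x'2, x'3 <- ΔH y'1)
  \sw_(x''1, x''2 <- ΔH x'')
    (x1 ▷ (a' * (x'1 ▷ a'') * σ (x'2 ⊗ x''1))) * σ (x2 ⊗ x'3 * x''2).
Proof.
sw_auto; sw_strip (ΔH x) => x1 y.
(* Reversed coassociativity collects two successive components into the coproduct of
   one element, to which the twisted module condition applies. *)
sw_rwr (coassocE cH y); sw_rwr (coassocE cH x').
sw_in (ΔH y) => y1 y2 : sw_in (ΔH x') => z1 z2 : sw_rw (sw_twistedA y1 z1 a'').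
sw_simpl; sw_strip (ΔH y) => y1 y2; sw_strip (ΔH x') => z1 z2.
sw_rw (sw_cocycleA y2 z2 x'').
by sw_simpl; sw_match.
Qed.

(** The mirror image of [assocA], computed from the other bracketing. *)
Lemma assocB x x' x'' b b' :
  (\sw_(x1, x2 <- ΔH x) \sw_(x'1, y'1 <- ΔH x') \sw_(x'2, x'3 <- ΔH y'1)
   \sw_(x''1, x''2 <- ΔH x'')
    τ (x1 * x'1 ⊗ x''1) * ((τ (x2 ⊗ x'2) * (b ◁ x'3) * b') ◁ x''2)) =
  \sw_(x'1, y'1 <- ΔH x') \sw_(x'2, x'3 <- ΔH y'1)
  \sw_(x''1, y1 <- ΔH x'') \sw_(x''2, y2 <- ΔH y1) \sw_(x''3, x''4 <- ΔH y2)
    τ (x ⊗ x'1 * x''1) * (b ◁ (x'2 * x''2)) * τ (x'3 ⊗ x''3) * (b' ◁ x''4).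
Proof.
symmetry; sw_simpl.
sw_in (ΔH x') => x1 x2 : sw_in (ΔH x'') => z1 z2 :
  (sw_rwr (coassocE cH z2); sw_in (ΔH z2) => z3 z4 : sw_rwr (sw_twistedB x2 z3 b)).
sw_simpl; sw_rwr (coassocE cH x'); sw_rwr (coassocE cH x'').
sw_in (ΔH x') => x1 x2 : sw_in (ΔH x'') => z1 z2 : sw_rwr (sw_cocycleB x x1 z1).
by sw_auto; sw_match.
Qed.

Lemma mul_assoc : associative mul.
Proof.
move=> u v w; move: u; apply: P_ext; [lin | lin | move=> a x b].
move: v; apply: P_ext; [lin | lin | move=> a' x' b'].
move: w; apply: P_ext; [lin | lin | move=> a'' x'' b''].
symmetry.
(* Either bracketing is a sum over threefold coproducts of x, x' and x'', with the
   first components in A and the third ones in B. *)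
transitivity
  (\sw_(x1, y1 <- ΔH x) \sw_(x2, x3 <- ΔH y1)
   \sw_(x'1, y'1 <- ΔH x') \sw_(x'2, x'3 <- ΔH y'1)
   \sw_(x''1, y''1 <- ΔH x'') \sw_(x''2, x''3 <- ΔH y''1)
     a * (\sw_(h1, k1 <- ΔH x1) \sw_(h2, k2 <- ΔH k1) \sw_(h3, h4 <- ΔH k2)
          \sw_(h'1, k'1 <- ΔH x'1) \sw_(h'2, h'3 <- ΔH k'1)
           (h1 ▷ a') * σ (h2 ⊗ h'1) * ((h3 * h'2) ▷ a'') * σ (h4 * h'3 ⊗ x''1))
     ⊗ x2 * x'2 * x''2 ⊗
     (\sw_(h1, h2 <- ΔH x3) \sw_(h'1, k'1 <- ΔH x'3) \sw_(h'2, h'3 <- ΔH k'1)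
      \sw_(h''1, h''2 <- ΔH x''3)
        τ (h1 * h'1 ⊗ h''1) * ((τ (h2 ⊗ h'2) * (b ◁ h'3) * b') ◁ h''2)) * b'').
  by sw_auto; sw_match.
sw_in (ΔH x) => x1 y1 : sw_in (ΔH y1) => x2 x3 :
   sw_in (ΔH x') => x'1 y'1 : sw_in (ΔH y'1) => x'2 x'3 :
   sw_in (ΔH x'') => x''1 y''1 : sw_in (ΔH y''1) => x''2 x''3 : rewrite assocA assocB.
by sw_auto; sw_match.
Qed.

(** * Coactions against cocycles and actions *)

(** These consequences of [condD19], [condD20] and [condD21] serve in both directions
    of the equivalence, so the three conditions are hypotheses here. *)
Section CoactionRules.
Variable Z : lmodType K.

Hypothesis D19 : forall a x,
    \sw_(am, az <- ρA a) am * x ⊗ (1 : B) ⊗ az =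
    \sw_(am, az <- ρA a) \sw_(am1, am2 <- ΔH am) \sw_(x1, x2 <- ΔH x)
      am1 * x1 ⊗ τ (am2 ⊗ x2) ⊗ az.

(** The counit in the H-component of [condD19].  Applied to the inner one of two
    successive coactions this formula gives [condD19] back. *)
Lemma sw_τ_coactA (f : B -> A -> Z) a x : bilin f ->
  (\sw_(am, az <- ρA a) f (τ (am ⊗ x)) az) = εH x *: f 1 a.
Proof.
case=> f1 f2.
apply: (sw3_congr (f := fun h b a => εH h *: f b a) (esym (D19 a x))); sw_norm.
Qed.

Hypothesis D20 : forall b x,
    \sw_(bz, bp <- ρB b) bz ⊗ (1 : A) ⊗ x * bp =
    \sw_(bz, bp <- ρB b) \sw_(x1, x2 <- ΔH x) \sw_(bp1, bp2 <- ΔH bp)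
      bz ⊗ σ (x1 ⊗ bp1) ⊗ x2 * bp2.

Lemma sw_σ_coactB (f : B -> A -> Z) b x : bilin f ->
  (\sw_(bz, bp <- ρB b) f bz (σ (x ⊗ bp))) = εH x *: f b 1.
Proof.
case=> f1 f2.
apply: (sw3_congr (f := fun b a h => εH h *: f b a) (esym (D20 b x))); sw_norm.
Qed.

Hypothesis D21 : forall a b,
    \sw_(am, az <- ρA a) \sw_(bz, bp <- ρB b) (bp ▷ az) ⊗ (bz ◁ am) = a ⊗ b.

Lemma sw_lact_ract (f : A -> B -> Z) a b : bilin f ->
  (\sw_(am, az <- ρA a) \sw_(bz, bp <- ρB b) f (bp ▷ az) (bz ◁ am)) = f a b.
Proof. by case=> f1 f2; apply: (sw2_congr (f := f) (D21 a b)); sw_norm. Qed.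

(** Both values of σ in the twisted module condition for x and b_[1] are trivial,
    the first one on the inner coaction of b and the second one on the outer one. *)
Lemma sw_lact_coactB (f : B -> A -> Z) b x a : bilin f ->
  (\sw_(bz, bp <- ρB b) f bz ((x * bp) ▷ a)) =
  \sw_(bz, bp <- ρB b) f bz (x ▷ (bp ▷ a)).
Proof.
case=> f1 f2.
transitivity (\sw_(bz, bp <- ρB b) \sw_(x1, x2 <- ΔH x) \sw_(h1, h2 <- ΔH bp)
    f bz (σ (x1 ⊗ h1) * ((x2 * h2) ▷ a))).
  symmetry; sw_simpl.
  sw_in (ρB b) => b0 k : sw_in (ΔH x) => x1 x2 : sw_rw (sw_σ_coactB b0 x1).
  by sw_simpl; sw_match.
sw_in (ρB b) => b0 k : sw_rw (sw_twistedA x k a).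
sw_simpl; sw_in (ΔH x) => x1 x2 : sw_rw (sw_σ_coactB b x2).
by sw_simpl; sw_match.
Qed.

Lemma sw_ract_coactA (f : B -> A -> Z) a b x : bilin f ->
  (\sw_(am, az <- ρA a) f (b ◁ (am * x)) az) =
  \sw_(am, az <- ρA a) f ((b ◁ am) ◁ x) az.
Proof.
case=> f1 f2.
transitivity (\sw_(am, az <- ρA a) \sw_(h1, h2 <- ΔH am) \sw_(x1, x2 <- ΔH x)
    f ((b ◁ (h1 * x1)) * τ (h2 ⊗ x2)) az).
  symmetry; sw_simpl.
  sw_in (ρA a) => h a0 : sw_in (ΔH x) => x1 x2 : sw_rw (sw_τ_coactA a0 x2).
  by sw_simpl; sw_match.
sw_in (ρA a) => h a0 : sw_rwr (sw_twistedB h x b).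
sw_simpl; sw_in (ΔH x) => x1 x2 : sw_rw (sw_τ_coactA a x1).
by sw_simpl; sw_match.
Qed.

Lemma sw_lact_ract_mul (f : A -> B -> Z) a b x x' : bilin f ->
  (\sw_(am, az <- ρA a) \sw_(bz, bp <- ρB b) f ((x * bp) ▷ az) (bz ◁ (am * x'))) =
  f (x ▷ a) (b ◁ x').
Proof.
case=> f1 f2.
sw_in (ρA a) => h a0 : sw_rw (sw_lact_coactB b x a0).
sw_in (ρB b) => b0 k : sw_rw (sw_ract_coactA a b0 x').
by sw_rw (sw_lact_ract a b).
Qed.
End CoactionRules.

(** * The structures on the triple tensor product *)

Lemma mul1P u : mul (two_sided_one H A B) u = u.
Proof.
move: u; apply: P_ext; [lin | lin | move=> a x b].
by rewrite /two_sided_one; sw_simpl.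
Qed.

Lemma mulP1 u : mul u (two_sided_one H A B) = u.
Proof.
move: u; apply: P_ext; [lin | lin | move=> a x b].
by rewrite /two_sided_one; sw_simpl.
Qed.

Lemma P_algebra : is_algebra mul (two_sided_one H A B).
Proof.
split; [exact: bilinP mul_bilin | exact: mul_assoc | exact: mul1P | exact: mulP1].
Qed.

(** The values of ε as scalars acting on K, the form in which the rules for counits
    apply to them. *)
Lemma counitZ u :
  ε u = \sw_(a, x, b <- u) εA a *: (εH x *: (εB b *: (1 : K^o))).
Proof.
by apply: eq_bigr => p _; apply: eq_bigr => q _; rewrite /GRing.scale /= mulr1 !mulrA.
Qed.

Lemma counit_lin : lin (ε : P -> K^o).
Proof.
have l : lin (fun u : P => \sw_(a, x, b <- u) εA a *: (εH x *: (εB b *: (1 : K^o)))).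
  by lin.
by move=> k u v; rewrite !counitZ l.
Qed.
#[local] Hint Resolve comul_lin counit_lin : lindb.

Lemma counitE a x b : ε (a ⊗ x ⊗ b) = εA a * εH x * εB b.
Proof.
rewrite counitZ; sw_simpl.
by rewrite /GRing.scale /= mulr1 !mulrA.
Qed.

Lemma comulE a x b : Δ (a ⊗ x ⊗ b) =
  \sw_(a1, a2 <- ΔA a) \sw_(a2m, a2z <- ρA a2)
  \sw_(x1, x2 <- ΔH x) \sw_(b1, b2 <- ΔB b) \sw_(b1z, b1p <- ρB b1)
    (a1 ⊗ a2m * x1 ⊗ b1z) ⊗ (a2z ⊗ x2 * b1p ⊗ b2).
Proof. by rewrite /two_sided_smash_comul; sw_flat. Qed.

Ltac sw_leaf_hook ::=
  progress rewrite ?(mulE, counitE, crossedE) ?lactM ?ractM ?mulrA -?scalerA.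

Lemma P_coalgebra : is_coalgebra Δ ε.
Proof.
split; [exact: comul_lin | exact: counit_lin | exact: comul_coassoc | |].
  apply: (P_ext (f := fun c => \sw_(c1, c2 <- Δ c) ε c1 *: c2) (g := id)).
  - by lin.
  - by lin.
  - by move=> a x b; rewrite comulE; sw_simpl.
apply: (P_ext (f := fun c => \sw_(c1, c2 <- Δ c) ε c2 *: c1) (g := id)).
- by lin.
- by lin.
- by move=> a x b; rewrite comulE; sw_simpl.
Qed.

Local Notation tmul := (tensor_mul mul).
Let tmul_linl v : lin (tmul^~ v) := (tensor_mul_bilin mul_bilin).1 v.
Let tmul_linr u : lin (tmul u) := (tensor_mul_bilin mul_bilin).2 u.
#[local] Hint Resolve tmul_linl tmul_linr : lindb.

(** * Products of elements of the three factors *)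

Definition inA (a : A) : P := a ⊗ 1 ⊗ 1.
Definition inH (x : H) : P := 1 ⊗ x ⊗ 1.
Definition inB (b : B) : P := 1 ⊗ 1 ⊗ b.

Lemma mul_AA a a' : mul (inA a) (inA a') = inA (a * a').
Proof. by rewrite /inA; sw_simpl. Qed.
Lemma mul_BB b b' : mul (inB b) (inB b') = inB (b * b').
Proof. by rewrite /inB; sw_simpl. Qed.
Lemma mul_AH a x : mul (inA a) (inH x) = a ⊗ x ⊗ 1.
Proof. by rewrite /inA /inH; sw_simpl. Qed.
Lemma mul_HB x b : mul (inH x) (inB b) = 1 ⊗ x ⊗ b.
Proof. by rewrite /inB /inH; sw_simpl. Qed.
Lemma mul_AH_B a x b : mul (a ⊗ x ⊗ 1) (inB b) = a ⊗ x ⊗ b.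
Proof. by rewrite /inB; sw_simpl. Qed.
Lemma mul_A_HB a x b : mul (inA a) (1 ⊗ x ⊗ b) = a ⊗ x ⊗ b.
Proof. by rewrite /inA; sw_simpl. Qed.
Lemma mul_HA x a : mul (inH x) (inA a) = \sw_(x1, x2 <- ΔH x) (x1 ▷ a) ⊗ x2 ⊗ 1.
Proof. by rewrite /inA /inH; sw_simpl. Qed.
Lemma mul_AB a b : mul (inA a) (inB b) = a ⊗ 1 ⊗ b.
Proof. by rewrite /inA /inB; sw_simpl. Qed.
Lemma mul_BA b a : mul (inB b) (inA a) = a ⊗ 1 ⊗ b.
Proof. by rewrite /inA /inB; sw_simpl. Qed.

Lemma mul_HH x x' : mul (inH x) (inH x') =
  \sw_(x1, y1 <- ΔH x) \sw_(x2, x3 <- ΔH y1)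
  \sw_(x'1, y'1 <- ΔH x') \sw_(x'2, x'3 <- ΔH y'1)
    σ (x1 ⊗ x'1) ⊗ x2 * x'2 ⊗ τ (x3 ⊗ x'3).
Proof. by rewrite /inH; sw_auto; sw_match. Qed.
Lemma mul_BH b x : mul (inB b) (inH x) = \sw_(x1, x2 <- ΔH x) 1 ⊗ x1 ⊗ (b ◁ x2).
Proof. by rewrite /inH /inB; sw_simpl. Qed.

(** * Reduction of multiplicativity to generators *)

Definition comul_multiplicative_at u v : Prop := Δ (mul u v) = tmul (Δ u) (Δ v).
Local Notation M := comul_multiplicative_at.

(** Both sides compare Δ(uvw) with Δ(u)Δ(v)Δ(w). *)
Lemma multiplicative_assoc u v w : M u v -> M v w -> M (mul u v) w <-> M u (mul v w).
Proof.
rewrite /M => uv vw; rewrite -mul_assoc uv vw.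
by rewrite (tensor_mulA mul_bilin mul_assoc).
Qed.

Lemma multiplicative_sw (V W : lmodType K) (t : (V ⊗ W)%type) (f : V -> W -> P) v :
  (forall x y, M (f x y) v) -> M (sweedler t f) v.
Proof.
rewrite /M => fv.
rewrite (sw_pull (c := fun u => Δ (mul u v))); last by lin.
rewrite (sw_pull (c := fun u => tmul (Δ u) (Δ v))); last by lin.
exact: sw_eq.
Qed.

Section Generators.
Hypothesis MAA : forall a a', M (inA a) (inA a').
Hypothesis MAH : forall a x, M (inA a) (inH x).
Hypothesis MAB : forall a b, M (inA a) (inB b).
Hypothesis MHA : forall x a, M (inH x) (inA a).
Hypothesis MHH : forall x x', M (inH x) (inH x').
Hypothesis MHB : forall x b, M (inH x) (inB b).
Hypothesis MBA : forall b a, M (inB b) (inA a).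
Hypothesis MBH : forall b x, M (inB b) (inH x).
Hypothesis MBB : forall b b', M (inB b) (inB b').
Hypothesis MAH_B : forall a x b, M (a ⊗ x ⊗ 1) (inB b).

Let M_B p b : M p (inB b).
Proof.
move: p; apply: P_ext; [lin | lin | move=> a x b0]; rewrite -/(M _ _) -mul_AH_B.
by rewrite (multiplicative_assoc (MAH_B a x b0) (MBB b0 b)) mul_BB.
Qed.

Let M_A_HB a x b : M (inA a) (1 ⊗ x ⊗ b).
Proof.
by rewrite -mul_HB -(multiplicative_assoc (MAH a x) (MHB x b)) mul_AH.
Qed.

Let MA_ a p : M (inA a) p.
Proof.
move: p; apply: P_ext; [lin | lin | move=> a' x b]; rewrite -/(M _ _) -mul_A_HB.
by rewrite -(multiplicative_assoc (MAA a a') (M_A_HB a' x b)) mul_AA.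
Qed.

Let MAH_H a x x' : M (a ⊗ x ⊗ 1) (inH x').
Proof. by rewrite -mul_AH (multiplicative_assoc (MAH a x) (MHH x x')). Qed.

Let MH_ x p : M (inH x) p.
Proof.
move: p; apply: P_ext; [lin | lin | move=> a x' b]; rewrite -/(M _ _) -mul_AH_B.
suff M_AH : M (inH x) (a ⊗ x' ⊗ 1).
  by rewrite -(multiplicative_assoc M_AH (MAH_B a x' b)).
rewrite -mul_AH -(multiplicative_assoc (MHA x a) (MAH a x')) mul_HA.
by apply: multiplicative_sw => x1 x2.
Qed.

Let MB_ b p : M (inB b) p.
Proof.
move: p; apply: P_ext; [lin | lin | move=> a x b']; rewrite -/(M _ _) -mul_AH_B.
suff M_AH : M (inB b) (a ⊗ x ⊗ 1).
  by rewrite -(multiplicative_assoc M_AH (MAH_B a x b')).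
rewrite -mul_AH -(multiplicative_assoc (MBA b a) (MAH a x)) mul_BA -mul_AB.
by rewrite (multiplicative_assoc (MAB a b) (MBH b x)).
Qed.

(** Since a·x·b ends in B, the pairs with second component in B come first.  Then
    come the pairs with first component in A, in H and in B: as x·a is a sum of
    products a'·x', and b·a = a·b, the last two cases fall back on that of A. *)
Lemma multiplicative_generators u p : M u p.
Proof.
move: u; apply: P_ext; [lin | lin | move=> a x b]; rewrite -/(M _ _) -mul_A_HB.
suff M_HB : M (1 ⊗ x ⊗ b) p by rewrite (multiplicative_assoc (M_A_HB a x b) M_HB).
by rewrite -mul_HB (multiplicative_assoc (MHB x b) (MB_ b p)).
Qed.
End Generators.

(** * Necessity of the conditions *)

Section Necessity.
Hypothesis hP : is_bialgebra mul (two_sided_one H A B) Δ ε.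

Let ΔPM u v : Δ (mul u v) = tmul (Δ u) (Δ v). Proof. exact: bialg_ΔM hP u v. Qed.
Let εPM u v : ε (mul u v) = ε u * ε v. Proof. exact: bialg_εM hP u v. Qed.

Lemma counitA_mul a a' : εA (a * a') = εA a * εA a'.
Proof.
by have := εPM (inA a) (inA a'); rewrite mul_AA !counitE εH1 εB1 !mulr1.
Qed.

Lemma counitB_mul b b' : εB (b * b') = εB b * εB b'.
Proof.
by have := εPM (inB b) (inB b'); rewrite mul_BB !counitE εH1 εA1 !mul1r.
Qed.

Let scale1K (k : K) : k *: (1 : K^o) = k.
Proof. by rewrite /GRing.scale /= mulr1. Qed.

Lemma counitA_lact x a : εA (x ▷ a) = εA a * εH x.
Proof.
rewrite -[LHS]scale1K -[RHS]scale1K.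
have := congr1 (fun k : K^o => k *: (1 : K^o)) (εPM (inH x) (inA a)).
rewrite /inH /inA !counitE εH1 εA1 εB1 !mulr1 mul1r mulrC => <-.
by symmetry; sw_simpl; rewrite εB1 !scale1r.
Qed.

Lemma counitB_ract b x : εB (b ◁ x) = εB b * εH x.
Proof.
rewrite -[LHS]scale1K -[RHS]scale1K.
have := congr1 (fun k : K^o => k *: (1 : K^o)) (εPM (inB b) (inH x)).
rewrite /inH /inB !counitE εH1 εA1 εB1 !mulr1 !mul1r => <-.
by symmetry; sw_simpl; rewrite εA1 !scale1r.
Qed.

Definition pA (p : P) : A := \sw_(a, x, b <- p) εH x *: (εB b *: a).
Definition pH (p : P) : H := \sw_(a, x, b <- p) εA a *: (εB b *: x).
Definition pB (p : P) : B := \sw_(a, x, b <- p) εA a *: (εH x *: b).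
Definition pAH (p : P) : (A ⊗ H)%type := \sw_(a, x, b <- p) εB b *: (a ⊗ x).
Definition pHB (p : P) : (H ⊗ B)%type := \sw_(a, x, b <- p) εA a *: (x ⊗ b).

Lemma pA_lin : lin pA. Proof. by rewrite /pA; lin. Qed.
Lemma pH_lin : lin pH. Proof. by rewrite /pH; lin. Qed.
Lemma pB_lin : lin pB. Proof. by rewrite /pB; lin. Qed.
Lemma pAH_lin : lin pAH. Proof. by rewrite /pAH; lin. Qed.
Lemma pHB_lin : lin pHB. Proof. by rewrite /pHB; lin. Qed.
#[local] Hint Resolve pA_lin pH_lin pB_lin pAH_lin pHB_lin : lindb.

Lemma pA_pure a x b : pA (a ⊗ x ⊗ b) = εH x *: (εB b *: a).
Proof. by rewrite /pA; sw_simpl. Qed.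
Lemma pH_pure a x b : pH (a ⊗ x ⊗ b) = εA a *: (εB b *: x).
Proof. by rewrite /pH; sw_simpl. Qed.
Lemma pB_pure a x b : pB (a ⊗ x ⊗ b) = εA a *: (εH x *: b).
Proof. by rewrite /pB; sw_simpl. Qed.
Lemma pAH_pure a x b : pAH (a ⊗ x ⊗ b) = εB b *: (a ⊗ x).
Proof. by rewrite /pAH; sw_simpl. Qed.
Lemma pHB_pure a x b : pHB (a ⊗ x ⊗ b) = εA a *: (x ⊗ b).
Proof. by rewrite /pHB; sw_simpl. Qed.

Let counitsE := (counitA_mul, counitB_mul, counitA_lact, counitB_ract,
  εAσ, εBτ, εA1, εB1, crossedE).
Let projE := (pA_pure, pH_pure, pB_pure, pAH_pure, pHB_pure).
Ltac sw_leaf_hook ::=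
  progress rewrite ?(projE, mulE, counitsE) ?lactM ?ractM ?mulrA -?scalerA.

Lemma pA_mul a x b a' x' b' : pA (mul (a ⊗ x ⊗ b) (a' ⊗ x' ⊗ b')) =
  \sw_(x1, x2 <- ΔH x) εB b *: (εB b' *: (a * (x1 ▷ a') * σ (x2 ⊗ x'))).
Proof. by sw_simpl; sw_match. Qed.

Lemma pH_mul a x b a' x' b' : pH (mul (a ⊗ x ⊗ b) (a' ⊗ x' ⊗ b')) =
  εA a *: (εA a' *: (εB b *: (εB b' *: (x * x')))).
Proof. by sw_simpl. Qed.

Lemma pB_mul a x b a' x' b' : pB (mul (a ⊗ x ⊗ b) (a' ⊗ x' ⊗ b')) =
  \sw_(x'1, x'2 <- ΔH x') εA a *: (εA a' *: (τ (x ⊗ x'1) * (b ◁ x'2) * b')).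
Proof. by sw_simpl; sw_match. Qed.

Lemma pAH_mul a x b a' x' b' : pAH (mul (a ⊗ x ⊗ b) (a' ⊗ x' ⊗ b')) =
  \sw_(x1, y1 <- ΔH x) \sw_(x2, x3 <- ΔH y1) \sw_(x'1, x'2 <- ΔH x')
    εB b *: (εB b' *: (a * (x1 ▷ a') * σ (x2 ⊗ x'1) ⊗ x3 * x'2)).
Proof. by sw_simpl; sw_match. Qed.

Lemma pHB_mul a x b a' x' b' : pHB (mul (a ⊗ x ⊗ b) (a' ⊗ x' ⊗ b')) =
  \sw_(x1, x2 <- ΔH x) \sw_(x'1, y'1 <- ΔH x') \sw_(x'2, x'3 <- ΔH y'1)
    εA a *: (εA a' *: (x1 * x'1 ⊗ τ (x2 ⊗ x'2) * (b ◁ x'3) * b')).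
Proof. by sw_simpl; sw_match. Qed.

(* From here on products are only ever projected, so they are not expanded. *)
Ltac sw_leaf_hook ::=
  progress rewrite ?(projE, pA_mul, pH_mul, pB_mul, pAH_mul, pHB_mul, counitsE)
    ?lactM ?ractM ?mulrA -?scalerA.

Ltac sw_rewrite_tensor :=
  lazymatch goal with
  | |- sweedler ?t ?f = _ =>
      eapply (@step_eq _ _ (fun s => sweedler s f) t);
      [ progress rewrite ?(comulE, tensor_mul_pure mul_bilin,
          pAH_pure, pHB_pure, pAH_mul, pHB_mul); reflexivity | ]
  end.

Ltac sw_tensor_hook ::=
  let go E := (lazymatch goal with
    |- sweedler ?t ?f = _ =>
      apply: (@step_eq _ _ (fun s => sweedler s f) _ _ _ E) end) in
  lazymatch goal with
  | |- sweedler ?t ?f = _ =>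
    lazymatch t with
    | ΔH (?x * ?y) => go (ΔHM x y)
    | ΔH 1 => go ΔH1
    | ?k *: ?u => apply: (@step_scale _ _ _ (fun s => sweedler s f) k u); [lin | ]
    | tensor_mul _ _ _ => sw_rewrite_tensor
    | two_sided_smash_comul _ _ _ _ _ _ => sw_rewrite_tensor
    | pAH _ => sw_rewrite_tensor
    | pHB _ => sw_rewrite_tensor
    end
  end.

Lemma comulA_one : ΔA 1 = 1 ⊗ 1.
Proof.
rewrite [ΔA 1]tensorE.
apply: (sw2_congr (f := fun p q => pA p ⊗ pA q) (bialg_Δ1 hP));
  by rewrite /two_sided_one; sw_auto; sw_match.
Qed.

Lemma coactA_one : ρA 1 = 1 ⊗ 1.
Proof.
rewrite [ρA 1]tensorE.
apply: (sw2_congr (f := fun p q => pH p ⊗ pA q) (bialg_Δ1 hP));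
  by rewrite /two_sided_one; sw_auto; sw_match.
Qed.

Lemma comulB_one : ΔB 1 = 1 ⊗ 1.
Proof.
rewrite [ΔB 1]tensorE.
apply: (sw2_congr (f := fun p q => pB p ⊗ pB q) (bialg_Δ1 hP));
  by rewrite /two_sided_one; sw_auto; sw_match.
Qed.

Lemma coactB_one : ρB 1 = 1 ⊗ 1.
Proof.
rewrite [ρB 1]tensorE.
apply: (sw2_congr (f := fun p q => pB p ⊗ pH q) (bialg_Δ1 hP));
  by rewrite /two_sided_one; sw_auto; sw_match.
Qed.

Ltac sw_tensor_hook ::=
  let go E := (lazymatch goal with
    |- sweedler ?t ?f = _ =>
      apply: (@step_eq _ _ (fun s => sweedler s f) _ _ _ E) end) in
  lazymatch goal with
  | |- sweedler ?t ?f = _ =>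
    lazymatch t with
    | ΔH (?x * ?y) => go (ΔHM x y)
    | ΔH 1 => go ΔH1
    | ΔA 1 => go comulA_one
    | ΔB 1 => go comulB_one
    | ρA 1 => go coactA_one
    | ρB 1 => go coactB_one
    | ?k *: ?u => apply: (@step_scale _ _ _ (fun s => sweedler s f) k u); [lin | ]
    | tensor_mul _ _ _ => sw_rewrite_tensor
    | two_sided_smash_comul _ _ _ _ _ _ => sw_rewrite_tensor
    | pAH _ => sw_rewrite_tensor
    | pHB _ => sw_rewrite_tensor
    end
  end.

Let productE :=
  (mul_AA, mul_AH, mul_HB, mul_HA, mul_BA, mul_BB, mul_HH, mul_BH).

(** Each of the following conditions is the multiplicativity of Δ on a product of two
    elements of A, H or B, projected to the factors that the condition speaks of. *)
Lemma comulA_σ_trivial a x :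
    \sw_(a1, a2 <- ΔA a) \sw_(a2m, a2z <- ρA a2) a1 ⊗ a2m * x ⊗ a2z =
    \sw_(a1, a2 <- ΔA a) \sw_(a2m, a2z <- ρA a2)
    \sw_(a2m1, a2m2 <- ΔH a2m) \sw_(x1, x2 <- ΔH x)
      a1 * σ (a2m1 ⊗ x1) ⊗ a2m2 * x2 ⊗ a2z.
Proof.
apply: (sw2_congr (f := fun p q => \sw_(h, k <- pAH p) h ⊗ k ⊗ pA q)
  (ΔPM (inA a) (inH x)));
  by rewrite ?productE /inA /inH /inB; sw_auto; sw_match.
Qed.

Lemma comulB_τ_trivial b x :
    \sw_(b1, b2 <- ΔB b) \sw_(b1z, b1p <- ρB b1) b1z ⊗ x * b1p ⊗ b2 =
    \sw_(b1, b2 <- ΔB b) \sw_(b1z, b1p <- ρB b1)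
    \sw_(b1p1, b1p2 <- ΔH b1p) \sw_(x1, x2 <- ΔH x)
      b1z ⊗ x1 * b1p1 ⊗ τ (x2 ⊗ b1p2) * b2.
Proof.
apply: (sw2_congr (f := fun p q => pB p ⊗ pHB q) (ΔPM (inH x) (inB b)));
  by rewrite ?productE /inA /inH /inB; sw_auto; sw_match.
Qed.

Lemma comulA_mul a a' :
    ΔA (a * a') =
    \sw_(a1, a2 <- ΔA a) \sw_(a2m, a2z <- ρA a2) \sw_(a2m1, a2m2 <- ΔH a2m)
    \sw_(a'1, a'2 <- ΔA a') \sw_(a'2m, a'2z <- ρA a'2)
      a1 * (a2m1 ▷ a'1) * σ (a2m2 ⊗ a'2m) ⊗ a2z * a'2z.
Proof.
rewrite [ΔA (a * a')]tensorE.
apply: (sw2_congr (f := fun p q => pA p ⊗ pA q) (ΔPM (inA a) (inA a')));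
  by rewrite ?productE /inA /inH /inB; sw_auto; sw_match.
Qed.

Lemma coactA_mul a a' :
    ρA (a * a') =
    \sw_(am, az <- ρA a) \sw_(a'm, a'z <- ρA a') am * a'm ⊗ az * a'z.
Proof.
rewrite [ρA (a * a')]tensorE.
apply: (sw2_congr (f := fun p q => pH p ⊗ pA q) (ΔPM (inA a) (inA a')));
  by rewrite ?productE /inA /inH /inB; sw_auto; sw_match.
Qed.

Lemma comulB_mul b b' :
    ΔB (b * b') =
    \sw_(b1, b2 <- ΔB b) \sw_(b1z, b1p <- ρB b1)
    \sw_(b'1, b'2 <- ΔB b') \sw_(b'1z, b'1p <- ρB b'1)
    \sw_(b'1p1, b'1p2 <- ΔH b'1p)
      b1z * b'1z ⊗ τ (b1p ⊗ b'1p1) * (b2 ◁ b'1p2) * b'2.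
Proof.
rewrite [ΔB (b * b')]tensorE.
apply: (sw2_congr (f := fun p q => pB p ⊗ pB q) (ΔPM (inB b) (inB b')));
  by rewrite ?productE /inA /inH /inB; sw_auto; sw_match.
Qed.

Lemma coactB_mul b b' :
    ρB (b * b') =
    \sw_(bz, bp <- ρB b) \sw_(b'z, b'p <- ρB b') bz * b'z ⊗ bp * b'p.
Proof.
rewrite [ρB (b * b')]tensorE.
apply: (sw2_congr (f := fun p q => pB p ⊗ pH q) (ΔPM (inB b) (inB b')));
  by rewrite ?productE /inA /inH /inB; sw_auto; sw_match.
Qed.

Lemma coactA_σ x x' :
    \sw_(x1, x2 <- ΔH x) \sw_(x'1, x'2 <- ΔH x')
    \sw_(sm, sz <- ρA (σ (x1 ⊗ x'1))) sm * x2 * x'2 ⊗ sz =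
    \sw_(x1, x2 <- ΔH x) \sw_(x'1, x'2 <- ΔH x') x1 * x'1 ⊗ σ (x2 ⊗ x'2).
Proof.
apply: (sw2_congr (f := fun p q => pH p ⊗ pA q) (ΔPM (inH x) (inH x')));
  by rewrite ?productE /inA /inH /inB; sw_auto; sw_match.
Qed.

Lemma comulA_σ x x' :
    ΔA (σ (x ⊗ x')) =
    \sw_(x1, x2 <- ΔH x) \sw_(x'1, x'2 <- ΔH x') σ (x1 ⊗ x'1) ⊗ σ (x2 ⊗ x'2).
Proof.
rewrite [ΔA (σ (x ⊗ x'))]tensorE.
apply: (sw2_congr (f := fun p q => pA p ⊗ pA q) (ΔPM (inH x) (inH x')));
  by rewrite ?productE /inA /inH /inB; sw_auto; sw_match.
Qed.

Lemma coactB_τ x x' :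
    \sw_(x1, x2 <- ΔH x) \sw_(x'1, x'2 <- ΔH x')
    \sw_(tz, tp <- ρB (τ (x2 ⊗ x'2))) tz ⊗ x1 * x'1 * tp =
    \sw_(x1, x2 <- ΔH x) \sw_(x'1, x'2 <- ΔH x') τ (x1 ⊗ x'1) ⊗ x2 * x'2.
Proof.
apply: (sw2_congr (f := fun p q => pB p ⊗ pH q) (ΔPM (inH x) (inH x')));
  by rewrite ?productE /inA /inH /inB; sw_auto; sw_match.
Qed.

Lemma comulB_τ x x' :
    ΔB (τ (x ⊗ x')) =
    \sw_(x1, x2 <- ΔH x) \sw_(x'1, x'2 <- ΔH x') τ (x1 ⊗ x'1) ⊗ τ (x2 ⊗ x'2).
Proof.
rewrite [ΔB (τ (x ⊗ x'))]tensorE.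
apply: (sw2_congr (f := fun p q => pB p ⊗ pB q) (ΔPM (inH x) (inH x')));
  by rewrite ?productE /inA /inH /inB; sw_auto; sw_match.
Qed.

Lemma comulA_lact x a :
    ΔA (x ▷ a) =
    \sw_(x1, x2, x3 <- comul3 ΔH x)
    \sw_(a1, a2 <- ΔA a) \sw_(a2m, a2z <- ρA a2)
      (x1 ▷ a1) * σ (x2 ⊗ a2m) ⊗ (x3 ▷ a2z).
Proof.
rewrite [ΔA (x ▷ a)]tensorE.
rewrite /comul3.
apply: (sw2_congr (f := fun p q => pA p ⊗ pA q) (ΔPM (inH x) (inA a)));
  by rewrite ?productE /inA /inH /inB; sw_auto; sw_match.
Qed.

Lemma coactA_lact x a :
    \sw_(x1, x2 <- ΔH x) \sw_(cm, cz <- ρA (x1 ▷ a)) cm * x2 ⊗ cz =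
    \sw_(x1, x2 <- ΔH x) \sw_(am, az <- ρA a) x1 * am ⊗ (x2 ▷ az).
Proof.
apply: (sw2_congr (f := fun p q => pH p ⊗ pA q) (ΔPM (inH x) (inA a)));
  by rewrite ?productE /inA /inH /inB; sw_auto; sw_match.
Qed.

Lemma coactB_ract b x :
    \sw_(x1, x2 <- ΔH x) \sw_(cz, cp <- ρB (b ◁ x2)) cz ⊗ x1 * cp =
    \sw_(x1, x2 <- ΔH x) \sw_(bz, bp <- ρB b) (bz ◁ x1) ⊗ bp * x2.
Proof.
apply: (sw2_congr (f := fun p q => pB p ⊗ pH q) (ΔPM (inB b) (inH x)));
  by rewrite ?productE /inA /inH /inB; sw_auto; sw_match.
Qed.

Lemma comulB_ract b x :
    ΔB (b ◁ x) =
    \sw_(b1, b2 <- ΔB b) \sw_(b1z, b1p <- ρB b1)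
    \sw_(x1, x2, x3 <- comul3 ΔH x)
      (b1z ◁ x1) ⊗ τ (b1p ⊗ x2) * (b2 ◁ x3).
Proof.
rewrite [ΔB (b ◁ x)]tensorE.
rewrite /comul3.
apply: (sw2_congr (f := fun p q => pB p ⊗ pB q) (ΔPM (inB b) (inH x)));
  by rewrite ?productE /inA /inH /inB; sw_auto; sw_match.
Qed.

Lemma coactA_τ_trivial a x :
    \sw_(am, az <- ρA a) am * x ⊗ (1 : B) ⊗ az =
    \sw_(am, az <- ρA a) \sw_(am1, am2 <- ΔH am) \sw_(x1, x2 <- ΔH x)
      am1 * x1 ⊗ τ (am2 ⊗ x2) ⊗ az.
Proof.
apply: (sw2_congr (f := fun p q => \sw_(h, k <- pHB p) h ⊗ k ⊗ pA q)
  (ΔPM (inA a) (inH x)));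
  by rewrite ?productE /inA /inH /inB; sw_auto; sw_match.
Qed.

Lemma coactB_σ_trivial b x :
    \sw_(bz, bp <- ρB b) bz ⊗ (1 : A) ⊗ x * bp =
    \sw_(bz, bp <- ρB b) \sw_(x1, x2 <- ΔH x) \sw_(bp1, bp2 <- ΔH bp)
      bz ⊗ σ (x1 ⊗ bp1) ⊗ x2 * bp2.
Proof.
apply: (sw2_congr (f := fun p q => pB p ⊗ pAH q) (ΔPM (inH x) (inB b)));
  by rewrite ?productE /inA /inH /inB; sw_auto; sw_match.
Qed.

Lemma lact_ract_cancel a b :
    \sw_(am, az <- ρA a) \sw_(bz, bp <- ρB b) (bp ▷ az) ⊗ (bz ◁ am) = a ⊗ b.
Proof.
apply: (sw2_congr (f := fun p q => pA q ⊗ pB p) (esym (ΔPM (inB b) (inA a))));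
  by rewrite ?productE /inA /inH /inB; sw_auto; sw_match.
Qed.

(** Multiplicativity in general, projected to B ⊗ A, has (a'_(-1) x')_2 acting on
    b_[0] and (x b_[1])_1 acting on a'_(0); [sw_lact_ract_mul] replaces them by
    components of x' and x. *)
Lemma τ_σ_exchange a a' b b' x x' :
    \sw_(x1, x2, x3 <- comul3 ΔH x) \sw_(x'1, x'2, x'3 <- comul3 ΔH x')
      τ (x3 ⊗ x'2) * (b ◁ x'3) * b' ⊗ a * (x1 ▷ a') * σ (x2 ⊗ x'1) =
    \sw_(am, az <- ρA a) \sw_(a'm, a'z <- ρA a')
    \sw_(bz, bp <- ρB b) \sw_(b'z, b'p <- ρB b')
    \sw_(x1, x2, x3 <- comul3 ΔH x) \sw_(x'1, x'2, x'3 <- comul3 ΔH x')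
      τ (am * x1 ⊗ a'm * x'1) * (bz ◁ x'2) * b'z
      ⊗ az * (x2 ▷ a'z) * σ (x3 * bp ⊗ x'3 * b'p).
Proof.
rewrite /comul3.
apply: (sw2_congr (f := fun p q => pB p ⊗ pA q) (ΔPM (a ⊗ x ⊗ b) (a' ⊗ x' ⊗ b'))).
  by rewrite mulE; sw_auto; sw_match.
sw_simpl; sw_in (ρB b) => b0 k : sw_in (ρA a') => h a0 :
  sw_in (ΔH x) => x1 y1 : sw_in (ΔH y1) => x2 x3 :
  sw_in (ΔH x') => x'1 y'1 : sw_in (ΔH y'1) => x'2 x'3 :
  sw_rw (sw_lact_ract_mul coactA_τ_trivial coactB_σ_trivial lact_ract_cancel a0 b0 x2 x'2).
by sw_auto; sw_match.
Qed.

Lemma conditions_necessary :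
  two_sided_conditions ΔH εH ΔA εA ρA ΔB εB ρB lact ract σ τ.
Proof.
split.
- by split; split=> //; [exact: counitA_mul | exact: counitB_mul].
- by split; [exact: comulA_one | exact: comulB_one].
- by split; [exact: coactA_one | exact: coactB_one].
- by split; [exact: counitA_lact | exact: counitB_ract].
- exact: comulA_σ_trivial.
- exact: comulB_τ_trivial.
- exact: comulA_mul.
- exact: coactA_mul.
- exact: comulB_mul.
- exact: coactB_mul.
- exact: coactA_σ.
- exact: comulA_σ.
- exact: coactB_τ.
- exact: comulB_τ.
- exact: comulA_lact.
- exact: coactA_lact.
- exact: coactB_ract.
- exact: comulB_ract.
- exact: coactA_τ_trivial.
- exact: coactB_σ_trivial.
- exact: lact_ract_cancel.
- exact: τ_σ_exchange.
Qed.
End Necessity.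

(** * Sufficiency of the conditions *)

Section Sufficiency.
Hypothesis hC : two_sided_conditions ΔH εH ΔA εA ρA ΔB εB ρB lact ract σ τ.

Let ΔA1 : ΔA 1 = 1 ⊗ 1. Proof. exact: (condC2 hC).1. Qed.
Let ΔB1 : ΔB 1 = 1 ⊗ 1. Proof. exact: (condC2 hC).2. Qed.
Let ρA1 : ρA 1 = 1 ⊗ 1. Proof. exact: (condC3 hC).1. Qed.
Let ρB1 : ρB 1 = 1 ⊗ 1. Proof. exact: (condC3 hC).2. Qed.

Ltac sw_leaf_hook ::=
  progress rewrite ?(mulE, comulE, tensor_mul_pure mul_bilin, counitE, crossedE)
    ?lactM ?ractM ?mulrA -?scalerA.

(* The conditions that express a coproduct or a coaction as a sum become
   simplification rules. *)
Ltac sw_tensor_hook ::=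
  let go E := (lazymatch goal with
    |- sweedler ?t ?f = _ =>
      apply: (@step_eq _ _ (fun s => sweedler s f) _ _ _ E) end) in
  lazymatch goal with
  | |- sweedler ?t _ = _ =>
    lazymatch t with
    | ΔH (?x * ?y) => go (ΔHM x y)
    | ΔH 1 => go ΔH1
    | ΔA 1 => go ΔA1
    | ΔB 1 => go ΔB1
    | ρA 1 => go ρA1
    | ρB 1 => go ρB1
    | ΔA (?x * ?y) => go (condD7 hC x y)
    | ΔB (?x * ?y) => go (condD9 hC x y)
    | ρA (?x * ?y) => go (condD8 hC x y)
    | ρB (?x * ?y) => go (condD10 hC x y)
    | ΔA (_ (?x ⊗ ?y)) =>
        first [ go (condD12 hC x y) | go (condD15 hC x y); rewrite /comul3 ]
    | ΔB (_ (?x ⊗ ?y)) =>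
        first [ go (condD14 hC x y) | go (condD18 hC x y); rewrite /comul3 ]
    end
  end.

(** The remaining conditions, for an arbitrary multilinear summand.  Of [condC5]
    and [condC6] only the counit in the H-component is kept, which is equivalent to the whole. *)
Section Rules.
Variable Z : lmodType K.

Lemma sw_σ_comulA (f : A -> A -> Z) a x : bilin f ->
  (\sw_(a1, a2 <- ΔA a) \sw_(a2m, a2z <- ρA a2) f (a1 * σ (a2m ⊗ x)) a2z) =
  εH x *: (\sw_(a1, a2 <- ΔA a) f a1 a2).
Proof.
case=> f1 f2; rewrite sw_scale.
apply: (sw3_congr (f := fun a h a' => εH h *: f a a') (esym (condC5 hC a x))); sw_norm.
Qed.

Lemma sw_τ_comulB (f : B -> B -> Z) b x : bilin f ->
  (\sw_(b1, b2 <- ΔB b) \sw_(b1z, b1p <- ρB b1) f b1z (τ (x ⊗ b1p) * b2)) =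
  εH x *: (\sw_(b1, b2 <- ΔB b) f b1 b2).
Proof.
case=> f1 f2; rewrite sw_scale.
apply: (sw3_congr (f := fun a h a' => εH h *: f a a') (esym (condC6 hC b x))); sw_norm.
Qed.

Lemma sw_coactA_σ (f : H -> A -> Z) x x' : bilin f ->
  (\sw_(x1, x2 <- ΔH x) \sw_(x'1, x'2 <- ΔH x')
   \sw_(sm, sz <- ρA (σ (x1 ⊗ x'1))) f (sm * x2 * x'2) sz) =
  \sw_(x1, x2 <- ΔH x) \sw_(x'1, x'2 <- ΔH x') f (x1 * x'1) (σ (x2 ⊗ x'2)).
Proof. by case=> f1 f2; apply: (sw2_congr (f := f) (condD11 hC x x')); sw_norm. Qed.

Lemma sw_coactB_τ (f : B -> H -> Z) x x' : bilin f ->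
  (\sw_(x1, x2 <- ΔH x) \sw_(x'1, x'2 <- ΔH x')
   \sw_(tz, tp <- ρB (τ (x2 ⊗ x'2))) f tz (x1 * x'1 * tp)) =
  \sw_(x1, x2 <- ΔH x) \sw_(x'1, x'2 <- ΔH x') f (τ (x1 ⊗ x'1)) (x2 * x'2).
Proof. by case=> f1 f2; apply: (sw2_congr (f := f) (condD13 hC x x')); sw_norm. Qed.

Lemma sw_coactA_lact (f : H -> A -> Z) x a : bilin f ->
  (\sw_(x1, x2 <- ΔH x) \sw_(cm, cz <- ρA (x1 ▷ a)) f (cm * x2) cz) =
  \sw_(x1, x2 <- ΔH x) \sw_(am, az <- ρA a) f (x1 * am) (x2 ▷ az).
Proof. by case=> f1 f2; apply: (sw2_congr (f := f) (condD16 hC x a)); sw_norm. Qed.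

Lemma sw_coactB_ract (f : B -> H -> Z) b x : bilin f ->
  (\sw_(x1, x2 <- ΔH x) \sw_(cz, cp <- ρB (b ◁ x2)) f cz (x1 * cp)) =
  \sw_(x1, x2 <- ΔH x) \sw_(bz, bp <- ρB b) f (bz ◁ x1) (bp * x2).
Proof. by case=> f1 f2; apply: (sw2_congr (f := f) (condD17 hC b x)); sw_norm. Qed.

(** [condD22] at a = b = b' = 1 and x' = 1. *)
Lemma sw_τ_lact (f : B -> A -> Z) x a : bilin f ->
  (\sw_(x1, x2 <- ΔH x) \sw_(am, az <- ρA a) f (τ (x1 ⊗ am)) (x2 ▷ az)) =
  f 1 (x ▷ a).
Proof.
case=> f1 f2; apply: (sw2_congr (f := f) (esym (condD22 hC 1 a 1 1 x 1))); rewrite /comul3.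
  by sw_simpl; sw_match.
by sw_norm.
Qed.

(** [condD22] at a = a' = b' = 1 and x = 1. *)
Lemma sw_σ_ract (f : B -> A -> Z) b x : bilin f ->
  (\sw_(x1, x2 <- ΔH x) \sw_(bz, bp <- ρB b) f (bz ◁ x1) (σ (bp ⊗ x2))) =
  f (b ◁ x) 1.
Proof.
case=> f1 f2; apply: (sw2_congr (f := f) (esym (condD22 hC 1 1 b 1 1 x))); rewrite /comul3.
  by sw_simpl; sw_match.
by sw_norm.
Qed.

(** [condD22] at a = a' = b = b' = 1. *)
Lemma sw_τ_σ_swap (f : B -> A -> Z) x x' : bilin f ->
  (\sw_(x1, x2 <- ΔH x) \sw_(x'1, x'2 <- ΔH x') f (τ (x2 ⊗ x'2)) (σ (x1 ⊗ x'1))) =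
  \sw_(x1, x2 <- ΔH x) \sw_(x'1, x'2 <- ΔH x') f (τ (x1 ⊗ x'1)) (σ (x2 ⊗ x'2)).
Proof.
case=> f1 f2; apply: (sw2_congr (f := f) (condD22 hC 1 1 1 1 x x')); rewrite /comul3; sw_norm.
Qed.
End Rules.

(** * Multiplicativity on generators *)

Lemma multiplicative_BA b a : M (inB b) (inA a).
Proof.
rewrite /M /inA /inB; sw_auto; sw_strip (ΔA a) => a1 a2; sw_strip (ρA a2) => h a0.
sw_strip (ΔB b) => b1 b2; sw_strip (ρB b1) => b0 k.
by symmetry; sw_rw (sw_lact_ract (condD21 hC) a0 b0).
Qed.

(** [condC5] removes σ and [condD19] removes τ. *)
Lemma multiplicative_AH a x : M (inA a) (inH x).
Proof.
rewrite /M /inA /inH /inB; symmetry; sw_simpl.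
sw_in (ΔH x) => x1 y1 : sw_rw (sw_σ_comulA a x1).
sw_simpl; sw_in (ΔA a) => a1 a2 : sw_in (ρA a2) => h a0 :
  sw_in (ΔH x) => x1 y1 : sw_in (ΔH y1) => x2 x3 : sw_rw (sw_τ_coactA (condD19 hC) a0 x2).
by sw_auto; sw_match.
Qed.

(** [condC6] removes τ and [condD20] removes σ. *)
Lemma multiplicative_AH_B a x b : M (a ⊗ x ⊗ 1) (inB b).
Proof.
rewrite /M /inA /inH /inB; symmetry; sw_simpl.
sw_in (ΔH x) => x1 y1 : sw_in (ΔH y1) => x2 y2 : sw_in (ΔH y2) => x3 x4 :
  sw_rw (sw_τ_comulB b x4).
sw_simpl; sw_in (ΔH x) => x1 y1 : sw_in (ΔH y1) => x2 x3 :
  sw_in (ΔB b) => b1 b2 : sw_in (ρB b1) => b0 k : sw_rw (sw_σ_coactB (condD20 hC) b0 x2).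
by sw_auto; sw_match.
Qed.

(** τ disappears by [sw_τ_lact]; on the other side [condD16] moves the
    coaction of x ▷ a to a. *)
Lemma multiplicative_HA x a : M (inH x) (inA a).
Proof.
rewrite /M /inA /inH /inB; symmetry; sw_simpl.
sw_in (ΔH x) => x1 y1 : sw_in (ΔH y1) => x2 y2 : sw_in (ΔH y2) => x3 y3 :
  (sw_rwr (coassocE cH y3); sw_in (ΔH y3) => x4 x5 :
   sw_in (ΔA a) => a1 a2 : sw_in (ρA a2) => h1 a3 : sw_in (ρA a3) => h2 a4 :
   sw_rw (sw_τ_lact x4 a4)).
sw_simpl; symmetry; sw_simpl.
sw_in (ΔH x) => x1 y1 : sw_in (ΔH y1) => x2 y2 :
  (sw_rwr (coassocE cH y2); sw_in (ΔH y2) => x3 x4 :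
   sw_in (ΔA a) => a1 a2 : sw_in (ρA a2) => h a0 : sw_rw (sw_coactA_lact x3 a0)).
by sw_simpl; sw_match.
Qed.

(** [condD7] and [condD8] are simplification rules; [condD19] removes τ. *)
Lemma multiplicative_AA a a' : M (inA a) (inA a').
Proof.
rewrite /M /inA /inH /inB; symmetry; sw_simpl.
sw_in (ΔA a) => a1 a2 : sw_in (ρA a2) => h1 a3 : sw_in (ρA a3) => h2 a4 :
  sw_in (ρA a4) => h3 a5 :
  sw_in (ΔA a') => a'1 a'2 : sw_in (ρA a'2) => k1 a'3 : sw_in (ρA a'3) => k2 a'4 :
  sw_in (ρA a'4) => k3 a'5 : sw_rw (sw_τ_coactA (condD19 hC) a5 k3).
by sw_auto; sw_match.
Qed.

Lemma multiplicative_HB x b : M (inH x) (inB b).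
Proof. exact: multiplicative_AH_B. Qed.

Lemma multiplicative_AB a b : M (inA a) (inB b).
Proof. exact: multiplicative_AH_B. Qed.

(** σ and τ are exchanged on the product side; on the other side [condD11] and
    [condD13] remove the coactions on the values of σ and τ. *)
Lemma multiplicative_HH x x' : M (inH x) (inH x').
Proof.
rewrite /M /inA /inH /inB; symmetry; sw_simpl.
sw_in (ΔH x) => x1 y1 : sw_in (ΔH y1) => x2 y2 :
  sw_in (ΔH x') => x'1 y'1 : sw_in (ΔH y'1) => x'2 y'2 :
  (sw_rwr (coassocE cH y2); sw_rwr (coassocE cH y'2);
   sw_in (ΔH y2) => x3 y3 : sw_in (ΔH y'2) => x'3 y'3 : sw_rwr (sw_τ_σ_swap x3 x'3)).
sw_simpl; symmetry; sw_simpl.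
sw_in (ΔH x) => x1 y1 : sw_in (ΔH x') => x'1 y'1 :
  (sw_rwr (coassocE cH y1); sw_rwr (coassocE cH y'1);
   sw_in (ΔH y1) => x2 y2 : sw_in (ΔH y'1) => x'2 y'2 : sw_rw (sw_coactA_σ x2 x'2)).
sw_simpl.
sw_in (ΔH x) => x1 y1 : sw_in (ΔH y1) => x2 y2 : sw_in (ΔH y2) => x3 y3 :
  sw_in (ΔH x') => x'1 y'1 : sw_in (ΔH y'1) => x'2 y'2 : sw_in (ΔH y'2) => x'3 y'3 :
  (sw_rwr (coassocE cH y3); sw_rwr (coassocE cH y'3);
   sw_in (ΔH y3) => x4 y4 : sw_in (ΔH y'3) => x'4 y'4 : sw_rw (sw_coactB_τ x4 x'4)).
by sw_simpl; sw_match.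
Qed.

(** The mirror image of the case H·A. *)
Lemma multiplicative_BH b x : M (inB b) (inH x).
Proof.
rewrite /M /inA /inH /inB; symmetry; sw_simpl.
sw_in (ΔH x) => x1 y1 :
  (sw_rwr (coassocE cH y1); sw_in (ΔH y1) => x2 y2 : sw_in (ΔB b) => b1 b2 :
   sw_in (ρB b1) => b3 k1 : sw_in (ρB b3) => b4 k2 : sw_rw (sw_σ_ract b4 x2)).
sw_simpl; symmetry; sw_simpl.
sw_in (ΔH x) => x1 y1 :
  (sw_rwr (coassocE cH y1); sw_in (ΔH y1) => x2 y2 : sw_in (ΔB b) => b1 b2 :
   sw_in (ρB b1) => b3 k1 : sw_rw (sw_coactB_ract b3 x2)).
by sw_simpl; sw_match.
Qed.

(** The mirror image of the case A·A. *)
Lemma multiplicative_BB b b' : M (inB b) (inB b').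
Proof.
rewrite /M /inA /inH /inB; symmetry; sw_simpl.
sw_in (ΔB b) => b1 b2 : sw_in (ρB b1) => b3 k1 : sw_in (ρB b3) => b4 k2 :
  sw_in (ρB b4) => b5 k3 :
  sw_in (ΔB b') => b'1 b'2 : sw_in (ρB b'1) => b'3 k'1 : sw_in (ρB b'3) => b'4 k'2 :
  sw_in (ρB b'4) => b'5 k'3 : sw_rw (sw_σ_coactB (condD20 hC) b'5 k3).
by sw_auto; sw_match.
Qed.

Let εAM a a' : εA (a * a') = εA a * εA a'. Proof. exact: (condC1 hC).1.2. Qed.
Let εBM b b' : εB (b * b') = εB b * εB b'. Proof. exact: (condC1 hC).2.2. Qed.
Let εA_lact x a : εA (x ▷ a) = εA a * εH x. Proof. exact: (condC4 hC).1. Qed.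
Let εB_ract b x : εB (b ◁ x) = εB b * εH x. Proof. exact: (condC4 hC).2. Qed.

Let counitsE := (εAM, εBM, εA_lact, εB_ract, εAσ, εBτ, εA1, εB1, crossedE).
Ltac sw_leaf_hook ::=
  progress rewrite ?(mulE, comulE, tensor_mul_pure mul_bilin, counitE, counitsE)
    ?lactM ?ractM ?mulrA -?scalerA.

Lemma counitM u v : ε (mul u v) = ε u * ε v.
Proof.
have E1 w : ε w *: (1 : K^o) = ε w by rewrite /GRing.scale /= mulr1.
rewrite -[LHS]E1 -[ε v]E1.
move: u; apply: (P_ext (f := fun u => ε (mul u v) *: (1 : K^o))
  (g := fun u => ε u *: (ε v *: (1 : K^o)))); [by lin | by lin | move=> a x b].
move: v; apply: (P_ext (f := fun v => ε (mul (a ⊗ x ⊗ b) v) *: (1 : K^o))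
  (g := fun v => ε (a ⊗ x ⊗ b) *: (ε v *: (1 : K^o))));
  [by lin | by lin | move=> a' x' b'].
sw_auto; rewrite /GRing.scale /=; congr (_ * _).
by rewrite mulrCA; congr (_ * _); exact: mulrCA.
Qed.

Lemma P_bialgebra :
  is_bialgebra mul (two_sided_one H A B) Δ ε.
Proof.
split.
- exact: P_algebra.
- exact: P_coalgebra.
- by rewrite /two_sided_one; sw_simpl.
- move=> u v.
  exact: (multiplicative_generators multiplicative_AA multiplicative_AH
    multiplicative_AB multiplicative_HA multiplicative_HH multiplicative_HB
    multiplicative_BA multiplicative_BH multiplicative_BB multiplicative_AH_B).
- by rewrite /two_sided_one counitE εA1 εB1 εH1 !mulr1.
- exact: counitM.
Qed.
End Sufficiency.

End TwoSided.

Theorem theorem3p2 (K : fieldType) (H A B : algType K)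
  (ΔH : H -> (H ⊗ H)%type) (εH : H -> K)
  (ΔA : A -> (A ⊗ A)%type) (εA : A -> K) (ρA : A -> (H ⊗ A)%type)
  (ΔB : B -> (B ⊗ B)%type) (εB : B -> K) (ρB : B -> (B ⊗ H)%type)
  (lact : {linear (H ⊗ A)%type -> A}) (ract : {linear (B ⊗ H)%type -> B})
  (σ : {linear (H ⊗ H)%type -> A}) (τ : {linear (H ⊗ H)%type -> B})
  (H_bialgebra : is_bialgebra *%R 1 ΔH εH)
  (A_comodule_coalgebra : is_left_comodule_coalgebra ΔH εH ΔA εA ρA)
  (A_weak_action : is_left_weak_action ΔH εH lact)
  (εA_one : εA 1 = 1)
  (εA_σ : forall x x' : H, εA (σ (x ⊗ x')) = εH x * εH x')
  (B_comodule_coalgebra : is_right_comodule_coalgebra ΔH εH ΔB εB ρB)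
  (B_weak_action : is_right_weak_action ΔH εH ract)
  (εB_one : εB 1 = 1)
  (εB_τ : forall x x' : H, εB (τ (x ⊗ x')) = εH x * εH x')
  (A_crossed_product : is_left_crossed_product ΔH εH lact σ)
  (B_crossed_product : is_right_crossed_product ΔH εH ract τ) :
  is_bialgebra
    (two_sided_crossed_mul ΔH lact ract σ τ) (two_sided_one H A B)
    (two_sided_smash_comul ΔH ΔA ρA ΔB ρB) (two_sided_smash_counit εH εA εB)
  <-> two_sided_conditions ΔH εH ΔA εA ρA ΔB εB ρB lact ract σ τ.
Proof.
split=> h; first by apply: conditions_necessary h; eassumption.
by apply: P_bialgebra h; eassumption.
Qed.
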